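(* Suppose that $\Gamma$ is a torsion-free hyperbolic group that is not free. Let $X=T_1\times\cdots\times T_n$ be a product of finite-valence trees, let $G_i=\mathrm{Aut}(T_i)$ and $G=\prod_{i=1}^n G_i$, and let $\sigma_i\colon G\to G_i$ be the projection. If $\rho\colon\Gamma\to G$ is a discrete and faithful representation, then there are at least two indices $i$ such that $\rho_i=\sigma_i\circ\rho$ is faithful and has indiscrete image. Moreover, suppose that $\rho_1,\dots,\rho_r$ are faithful representations and the other $\rho_i$ are not. Then the representation \[ \rho_1\times\cdots\times\rho_r\colon \Gamma\to G_1\times\cdots\times G_r \] is discrete and faithful.
   Context: Hyperbolic means Gromov hyperbolic (in particular finitely generated). A finite-valence tree is a simplicial tree in which every vertex has finite valence. $\mathrm{Aut}(T_i)$ carries its usual topology (compact-open, equivalently pointwise convergence on vertices), and products of such groups carry the product topology. A representation is faithful if it is injective and discrete if its image is a discrete subgroup; its image is indiscrete if it is not a discrete subgroup. *)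

(* Defs.v *)
From HB Require Import structures.
From mathcomp Require Import all_boot all_order all_algebra.
From mathcomp Require Import all_classical topology.

Set Implicit Arguments.
Unset Strict Implicit.
Unset Printing Implicit Defensive.

Import Order.TTheory GRing.Theory Num.Theory.
Local Open Scope classical_set_scope.

Section Words.
Variable Gamma : groupType.
Implicit Types (S : set Gamma) (w : seq (Gamma * bool)) (g : Gamma).

(* The letter (s, false) stands for s and (s, true) for its formal inverse. *)
Definition letter_eval (l : Gamma * bool) : Gamma :=
  (if l.2 then l.1^-1 else l.1)%g.

Definition word_eval w : Gamma := (\prod_(l <- w) letter_eval l)%g.

Definition word_over S w : Prop := {in w, forall l, S l.1}.

Definition reduced (w : seq (Gamma * bool)) : bool :=
  sorted (fun l m => ~~ ((l.1 == m.1) && (l.2 != m.2))) w.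

Definition free_basis S : Prop :=
  forall g, exists! w, [/\ word_over S w, reduced w & word_eval w = g].

Definition generates S : Prop :=
  forall g, exists2 w, word_over S w & word_eval w = g.

Definition is_word_length S g (k : nat) : Prop :=
  (exists w, [/\ word_over S w, word_eval w = g & size w = k]) /\
  (forall w, word_over S w -> word_eval w = g -> (k <= size w)%N).

(* The default value 0 is only taken when g is not in the subgroup generated
   by S. *)
Definition word_length S g : nat := xget 0%N (is_word_length S g).

Definition word_dist S (g h : Gamma) : nat := word_length S (g^-1 * h)%g.

End Words.

Definition free_group (Gamma : groupType) : Prop :=
  exists S : set Gamma, free_basis S.

Definition torsion_free (Gamma : groupType) : Prop :=
  forall (g : Gamma) (k : nat), (0 < k)%N -> (g ^+ k = 1)%g -> g = 1%g.

Definition gromov_product (X : Type) (d : X -> X -> nat) (p x y : X) : rat :=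
  (((d p x)%:R + (d p y)%:R - (d x y)%:R) / 2%:R)%R.

(* The distances involved are integers, so that a real constant delta exists
   if and only if a rational one does. *)
Definition gromov_hyperbolic (X : Type) (d : X -> X -> nat) : Prop :=
  exists delta : rat, forall p x y z : X,
    (Num.min (gromov_product d p x y) (gromov_product d p y z) - delta
       <= gromov_product d p x z)%R.

Definition hyperbolic_group (Gamma : groupType) : Prop :=
  exists S : set Gamma,
    [/\ finite_set S, generates S & gromov_hyperbolic (word_dist S)].

Record graph := Graph {
  vertex :> choiceType;
  adj : rel vertex;
  adj_sym : symmetric adj;
  adj_irr : irreflexive adj
}.

Definition connected_graph (T : graph) : Prop :=
  forall x y : T, exists2 p : seq T, path (@adj T) x p & last x p = y.

(* A duplicate-free cyclic list of length 2 merely runs back and forth along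
   one edge; the circuits are those of length at least 3. *)
Definition acyclic_graph (T : graph) : Prop :=
  forall c : seq T, ucycle (@adj T) c -> (size c <= 2)%N.

Definition is_tree (T : graph) : Prop :=
  [/\ inhabited T, connected_graph T & acyclic_graph T].

Definition finite_valence (T : graph) : Prop :=
  forall x : T, finite_set [set y : T | adj x y].

(* {ptws _ -> _} carries the topology of pointwise convergence. *)
Definition automorphisms (T : graph) : set {ptws T -> discrete_topology T} :=
  [set f | bijective f /\ {mono f : x y / adj (x : T) (y : T)}].

Definition graph_aut (T : graph) : Type := set_type (@automorphisms T).

HB.instance Definition _ (T : graph) :=
  Topological.copy (graph_aut T) (set_type (@automorphisms T)).

Section AutGroup.
Variable T : graph.

Definition aut_fun (f : graph_aut T) : T -> T := \val f.

Lemma aut_funP (f : graph_aut T) :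
  bijective (aut_fun f) /\ {mono aut_fun f : x y / adj x y}.
Proof. by have := set_mem (valP f). Qed.

Definition mk_aut (f : T -> T) (bf : bijective f)
    (mf : {mono f : x y / adj x y}) : graph_aut T :=
  exist _ (f : {ptws T -> discrete_topology T})
    (mem_set (conj bf mf : automorphisms f)).

Lemma aut_eqP (f g : graph_aut T) : aut_fun f =1 aut_fun g -> f = g.
Proof. by move=> fg; apply: val_inj; apply: funext => x; exact: fg. Qed.

Definition aut_one : graph_aut T :=
  @mk_aut id (inv_bij (fun _ => erefl)) (fun _ _ => erefl).

Definition aut_mul (f g : graph_aut T) : graph_aut T :=
  @mk_aut (aut_fun f \o aut_fun g)
    (bij_comp (aut_funP f).1 (aut_funP g).1)
    (fun x y => etrans ((aut_funP f).2 _ _) ((aut_funP g).2 x y)).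

Lemma aut_inv_subproof (f : graph_aut T) :
  exists g : graph_aut T, cancel (aut_fun f) (aut_fun g) /\
                    cancel (aut_fun g) (aut_fun f).
Proof.
have [[h fK hK] mf] := aut_funP f.
have mh : {mono h : x y / adj x y} by move=> x y; rewrite -mf !hK.
by exists (@mk_aut h (Bijective hK fK) mh).
Qed.

Definition aut_inv (f : graph_aut T) : graph_aut T := projT1 (cid (aut_inv_subproof f)).

Lemma aut_invP (f : graph_aut T) :
  cancel (aut_fun f) (aut_fun (aut_inv f)) /\
  cancel (aut_fun (aut_inv f)) (aut_fun f).
Proof. exact: (projT2 (cid (aut_inv_subproof f))). Qed.

Lemma aut_mulA : associative aut_mul.
Proof. by move=> f g h; exact: aut_eqP. Qed.
Lemma aut_mul1 : left_id aut_one aut_mul.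
Proof. by move=> f; exact: aut_eqP. Qed.
Lemma aut_mulr1 : right_id aut_one aut_mul.
Proof. by move=> f; exact: aut_eqP. Qed.
Lemma aut_mulV : left_inverse aut_one aut_inv aut_mul.
Proof. by move=> f; apply: aut_eqP => x; exact: (aut_invP f).1. Qed.
Lemma aut_mulrV : right_inverse aut_one aut_inv aut_mul.
Proof. by move=> f; apply: aut_eqP => x; exact: (aut_invP f).2. Qed.

HB.instance Definition _ := isGroup.Build (graph_aut T)
  aut_mulA aut_mul1 aut_mulr1 aut_mulV aut_mulrV.

End AutGroup.

Section ProductGroup.
Variables (I : Type) (G : I -> groupType).
Local Open Scope group_scope.

Definition prod_one : prod_topology G := fun i => 1.
Definition prod_mul (f g : prod_topology G) : prod_topology G :=
  fun i => f i * g i.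
Definition prod_inv (f : prod_topology G) : prod_topology G :=
  fun i => (f i)^-1.

Lemma prod_mulA : associative prod_mul.
Proof. by move=> f g h; apply: functional_extensionality_dep => i; exact: mulgA. Qed.
Lemma prod_mul1 : left_id prod_one prod_mul.
Proof. by move=> f; apply: functional_extensionality_dep => i; exact: mul1g. Qed.
Lemma prod_mulr1 : right_id prod_one prod_mul.
Proof. by move=> f; apply: functional_extensionality_dep => i; exact: mulg1. Qed.
Lemma prod_mulV : left_inverse prod_one prod_inv prod_mul.
Proof. by move=> f; apply: functional_extensionality_dep => i; exact: mulVg. Qed.
Lemma prod_mulrV : right_inverse prod_one prod_inv prod_mul.
Proof. by move=> f; apply: functional_extensionality_dep => i; exact: mulgV. Qed.

End ProductGroup.

(* The product of the groups graph_aut (T i): componentwise group law, together with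
   the product topology of the pointwise convergence topologies. *)
Definition ProdAut (I : Type) (T : I -> graph) : Type :=
  prod_topology (fun i => graph_aut (T i)).

HB.instance Definition _ (I : Type) (T : I -> graph) :=
  Topological.copy (ProdAut T) (prod_topology (fun i => graph_aut (T i))).

HB.instance Definition _ (I : Type) (T : I -> graph) :=
  @isGroup.Build (ProdAut T)
    (@prod_one I (fun i => graph_aut (T i))) (@prod_inv I (fun i => graph_aut (T i)))
    (@prod_mul I (fun i => graph_aut (T i)))
    (@prod_mulA I (fun i => graph_aut (T i))) (@prod_mul1 I (fun i => graph_aut (T i)))
    (@prod_mulr1 I (fun i => graph_aut (T i))) (@prod_mulV I (fun i => graph_aut (T i)))
    (@prod_mulrV I (fun i => graph_aut (T i))).

Definition ProdAut_proj (I : Type) (T : I -> graph) (i : I) :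
  ProdAut T -> graph_aut (T i) := @proj I (fun i => graph_aut (T i)) i.

Definition rep_prod (Gamma J : Type) (T : J -> graph)
    (rho : forall j, Gamma -> graph_aut (T j)) : Gamma -> ProdAut T :=
  fun g j => rho j g.

Definition faithful_rep (Gamma G : Type) (rho : Gamma -> G) : Prop :=
  injective rho.

(* Every point of the subset A is isolated in A, that is, the subspace topology
   on A is discrete; A is not required to be closed. *)
Definition discrete_set (G : topologicalType) (A : set G) : Prop :=
  A `<=` isolated A.

Definition discrete_rep (Gamma : Type) (G : topologicalType)
    (rho : Gamma -> G) : Prop := discrete_set (range rho).

(* Main.v *)
Require Import Defs.
From HB Require Import structures.
From mathcomp Require Import all_boot all_order all_algebra.
From mathcomp Require Import all_classical topology.
From mathcomp Require Import zify lra.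

(** Let Gamma act on each tree T_i through rho_i. Two facts carry the proof.

    The first concerns hyperbolic groups: if Gamma is torsion-free hyperbolic
    and not free, nontrivial normal subgroups of Gamma have trivial centralizer
    (normal_centralizer_free), and commuting with a given nontrivial element is
    transitive (commuting_transitive). For some power h of a nontrivial element,
    the powers of h form a quasi-geodesic (doubling_gap, pow_dist_superadd). An
    element that commutes with h moves this quasi-geodesic to a parallel one, so
    that by thinness of quadrilaterals it lies in one of finitely many cosets of
    the group generated by h (commute_near_pow). The transfer then embeds the
    centralizer of h in the integers (centralizer_embeds_int), and both
    statements follow from that.

    The second is that a torsion-free group which acts freely on a tree is free
    (free_action_on_tree_free). If the common fixer in Gamma of finitely many
    vertices of the single tree T_i is trivial, then vertex stabilizers are
    trivial, because in a locally finite tree an element that fixes a vertex has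
    finite orbits; so Gamma would be free (trivial_fixer_free). In particular no
    rho_i is both faithful and discrete.

    Now let rho be discrete and faithful: finitely many vertices of the trees
    have trivial common fixer. The kernels of those rho_i that are not faithful
    are nontrivial normal subgroups. So is their intersection, since nontrivial
    normal subgroups with trivial intersection would centralize each other
    (common_kernel_nontrivial), and it contains noncommuting elements k1 and k2.
    If g fixes enough vertices of the trees on which Gamma acts faithfully, the
    commutators of g with k1 and k2 fix the given vertices in all trees, hence
    are trivial, which forces g = 1 (faithful_trivial_fixer). So the faithful
    rho_i alone define a discrete representation; there are at least two of
    them, since otherwise Gamma would be free. *)

Set Implicit Arguments.
Unset Strict Implicit.
Unset Printing Implicit Defensive.

Import Order.TTheory GRing.Theory Num.Theory.

Lemma seq_pigeonhole (A : eqType) (L : seq A) (f : nat -> A) :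
  (forall j, (j <= size L)%N -> f j \in L) ->
  exists a b, (a < b)%N /\ f a = f b.
Proof.
move=> fL; apply: contrapT => noab.
have fsub : {subset [seq f j | j <- iota 0 (size L).+1] <= L}.
  by move=> _ /mapP[j + ->]; rewrite mem_iota => /andP[_ jL]; apply: fL.
have /uniq_leq_size/(_ fsub) : uniq [seq f j | j <- iota 0 (size L).+1].
  rewrite map_inj_in_uniq ?iota_uniq // => a b _ _ fab.
  by case: (ltngtP a b) => // ab; case: noab; [exists a, b|exists b, a].
by rewrite size_map size_iota ltnn.
Qed.

(** * Hyperbolic left-invariant metrics on groups *)

Section HyperbolicMetric.
Local Open Scope group_scope.
Variables (Gamma : groupType) (d : Gamma -> Gamma -> nat) (e : nat).
Implicit Types (x y z g h : Gamma) (i j n : nat).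
Hypothesis dxx : forall x, d x x = 0%N.
Hypothesis dC : forall x y, d x y = d y x.
Hypothesis d_triangle : forall y x z, (d x z <= d x y + d y z)%N.
Hypothesis dM : forall g x y, d (g * x) (g * y) = d x y.
(* This is the hyperbolicity inequality for Gromov products, with their
   definition expanded; e is at least twice the hyperbolicity constant. *)
Hypothesis four_point : forall x y z p,
  (d x z + d p y <= maxn (d x y + d p z) (d y z + d p x) + e)%N.
Hypothesis midpoint : forall g k, (k <= d 1 g)%N ->
  exists2 m, (d m 1 <= k)%N & (d m g <= d 1 g - k)%N.
Hypothesis finite_balls : forall R, exists L : seq Gamma,
  forall x, (d 1 x <= R)%N -> x \in L.

Lemma dist_pow g i j : d (g ^+ i) (g ^+ j) = d 1 (g ^+ ((i - j) + (j - i))).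
Proof.
wlog ij : i j / (i <= j)%N => [Hw|].
  by case/orP: (leq_total i j) => /Hw // H; rewrite dC H addnC.
rewrite -{1}(subnKC ij) expgnDr -{1}[g ^+ i]mulg1 dM.
by congr (d 1 (g ^+ _)); lia.
Qed.

(** If no power of g gained length C when squared, the lengths of the first 2N
    powers would exceed their maximum D over the first N by at most a constant
    B. The orbit of 1 under these powers then has diameter about D, so a
    midpoint m of a longest chord is an approximate centre of it, and so are
    the translates of m by the first N powers. In a hyperbolic space two
    approximate centres are at bounded distance; the bound does not involve N,
    and for N the number of elements of the corresponding ball two of the
    conjugates of powers of g by m coincide. *)
Lemma doubling_gap g C : injective (fun n => g ^+ n) ->
  exists2 k, (0 < k)%N & (d 1 (g ^+ k) + C <= d 1 (g ^+ (2 * k)))%N.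
Proof.
move=> inj_g; apply: contrapT => noP.
pose a i := d 1 (g ^+ i).
have aE i : d 1 (g ^+ i) = a i by [].
have a0 : a 0%N = 0%N by rewrite /a expg0 dxx.
have dXa i j : d (g ^+ i) (g ^+ j) = a ((i - j) + (j - i))%N by rewrite dist_pow.
have gapN k : (a (2 * k) <= a k + C)%N.
  case: (posnP k) => [->|k0]; first by rewrite muln0 a0.
  by rewrite leqNgt; apply/negP => H; apply: noP; exists k => //; move: H; rewrite /a; lia.
have aS i : (a i.+1 <= a i + a 1)%N.
  rewrite -[a 1%N](_ : d (g ^+ i) (g ^+ i.+1) = _); first exact: d_triangle.
  by rewrite dXa; congr a; lia.
(* C accounts for doubling an exponent, a 1 for making it odd. *)
pose B := (C + a 1)%N.
have [L LP] := finite_balls (B + 2 * e + 3).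
pose N := size L.
have [k _ kmax] := @arg_maxnP _ (@ord0 N) xpredT (fun i : 'I_N.+1 => a i) isT.
set D := a k in kmax.
have kN : (k <= N)%N by rewrite -ltnS.
have aN i : (i <= N)%N -> (a i <= D)%N.
  by rewrite -ltnS => iN; exact: (kmax (Ordinal iN)).
have a2N i : (i <= 2 * N)%N -> (a i <= D + B)%N.
  move=> iN; rewrite [i in a i](_ : i = odd i + 2 * i./2)%N; last by lia.
  have /aN : (i./2 <= N)%N by lia.
  have := gapN i./2; have := aS (2 * i./2)%N.
  by case: (odd i); rewrite /= ?add1n ?add0n /B; move: iN; lia.
have Dk : (uphalf D <= d 1 (g ^+ k))%N by rewrite aE -/D; lia.
have [m m1 mk] := midpoint Dk.
have {}mk : (d m (g ^+ k) <= uphalf D)%N by move: mk; rewrite aE -/D; lia.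
have D1k : d 1 (g ^+ k) = D by [].
have near j : (j <= N)%N -> (d m (g ^+ j * m) <= B + 2 * e + 3)%N.
  move=> jN; set x := g ^+ j * m.
  have xj : (d x (g ^+ j) <= uphalf D)%N by rewrite -[g ^+ j]mulg1 dM.
  have xjk : (d x (g ^+ (j + k)) <= uphalf D)%N by rewrite expgnDr dM.
  have Djk : d (g ^+ j) (g ^+ (j + k)) = D by rewrite dXa; congr a; lia.
  have x1 : (d x 1 <= uphalf D + B + e)%N.
    have := four_point x (g ^+ j) 1 (g ^+ (j + k)).
    rewrite (dC (g ^+ (j + k)) (g ^+ j)) Djk (dC (g ^+ (j + k)) x).
    rewrite (dC (g ^+ (j + k)) 1) (dC (g ^+ j) 1) !aE.
    have := a2N (j + k)%N; have := aN j; lia.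
  have xk : (d x (g ^+ k) <= uphalf D + B + e)%N.
    have := four_point x (g ^+ j) (g ^+ k) (g ^+ (j + k)).
    rewrite (dC (g ^+ (j + k)) (g ^+ j)) Djk (dC (g ^+ (j + k)) x) !dXa.
    have := aN (j + k - k + (k - (j + k)))%N; have := aN (j - k + (k - j))%N; lia.
  have := four_point m 1 x (g ^+ k).
  by rewrite (dC (g ^+ k) 1) D1k (dC (g ^+ k) x) (dC (g ^+ k) m) (dC 1 x); lia.
have fL j : (j <= N)%N -> m^-1 * (g ^+ j * m) \in L.
  by move=> jN; apply: LP; rewrite -(dM m) mulg1 mulVKg; apply: near.
by have [i [j [ij /mulgI /mulIg /inj_g E]]] := seq_pigeonhole fL; rewrite E ltnn in ij.
Qed.

(** An isometry that moves a point much less than its square does has no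
    almost-fixed point: its powers go off to infinity along a quasi-geodesic. *)
Section Quasigeodesic.
Variables (h : Gamma).
Local Notation a n := (d 1 (h ^+ n)).
Hypothesis gap : (a 1 + (2 * e + 1) <= a 2)%N.

Let a0 : a 0%N = 0%N. Proof. by rewrite expg0 dxx. Qed.

Let dXa i j : d (h ^+ i) (h ^+ j) = a ((i - j) + (j - i))%N.
Proof. by rewrite dist_pow. Qed.

Let aS n : (a n.+1 <= a n + a 1)%N.
Proof.
rewrite -[a 1%N](_ : d (h ^+ n) (h ^+ n.+1) = _); first exact: d_triangle.
by rewrite dXa; congr (d 1 (h ^+ _)); lia.
Qed.

(** Apply the four-point inequality to three consecutive powers and the base
    point: of the two alternatives the gap and the previous step of the
    induction leave only this one. *)
Lemma pow_dist_growth n : (a n + e + 1 <= a n.+1)%N.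
Proof.
elim: n => [|n IHn].
  by have := aS 1%N; move: gap; rewrite a0; lia.
have := four_point (h ^+ n) (h ^+ 0) (h ^+ n.+2) (h ^+ n.+1).
rewrite !dXa.
have -> : (n - n.+2 + (n.+2 - n) = 2)%N by lia.
have -> : (n.+1 - 0 + (0 - n.+1) = n.+1)%N by lia.
have -> : (n - 0 + (0 - n) = n)%N by lia.
have -> : (n.+1 - n.+2 + (n.+2 - n.+1) = 1)%N by lia.
have -> : (0 - n.+2 + (n.+2 - 0) = n.+2)%N by lia.
have -> : (n.+1 - n + (n - n.+1) = 1)%N by lia.
move: gap IHn; lia.
Qed.

Lemma pow_dist_ge n : (n <= a n)%N.
Proof. elim: n => // n IHn; have := pow_dist_growth n; lia. Qed.

(** Each power of h is uniformly close to any geodesic from 1 to a later power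
    of h. *)
Lemma pow_dist_superadd i j : (a i + a j <= a (i + j) + a 1 + e)%N.
Proof.
case: j => [|j]; first by rewrite addn0 a0; lia.
have := four_point (h ^+ j) (h ^+ 0) (h ^+ (i + j.+1)) (h ^+ j.+1).
rewrite !dXa.
have -> : (j - (i + j.+1) + (i + j.+1 - j) = i.+1)%N by lia.
have -> : (j.+1 - 0 + (0 - j.+1) = j.+1)%N by lia.
have -> : (j - 0 + (0 - j) = j)%N by lia.
have -> : (j.+1 - (i + j.+1) + (i + j.+1 - j.+1) = i)%N by lia.
have -> : (0 - (i + j.+1) + (i + j.+1 - 0) = i + j.+1)%N by lia.
have -> : (j.+1 - j + (j - j.+1) = 1)%N by lia.
have := pow_dist_growth i; have := pow_dist_growth j; lia.
Qed.

Lemma pow_dist_dense u n : (u <= a n)%N ->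
  exists i, [/\ (i <= n)%N, (a i <= u)%N & (u <= a i + a 1)%N].
Proof.
elim: n => [|n IHn] un; first by exists 0%N; split=> //; move: un; lia.
case: (leqP u (a n)) => [/IHn[i [? ? ?]]|nu]; first by exists i; split=> //; lia.
by exists n; split=> //; have := aS n; lia.
Qed.

(** The orbit of 1 under h and its translate by x are two quasi-geodesics at
    constant distance r, as x commutes with h. Over a length that is large
    against r they form a thin quadrilateral, whose short sides are far from
    the middle: there the two orbits are at a distance bounded in terms of h
    alone. Hence x lies, up to powers of h on both sides, in a fixed ball. *)
Lemma commute_near_pow x : commute x h ->
  exists m i, (d (h ^+ m) (x * h ^+ i) <= 2 * a 1 + 10 * e)%N.
Proof.
move=> xh; set r := d 1 x; set K := (a 1 + e)%N.
pose m := (K + 4 * r + 2 * e + 1)%N.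
have am := pow_dist_ge m; have a2m := pow_dist_ge (m + m).
have am2 := pow_dist_superadd m m.
have hx i : d (h ^+ i) (x * h ^+ i) = r.
  by rewrite (commuteX i xh) -{1}[h ^+ i]mulg1 dM.
have dp i j : d (x * h ^+ i) (x * h ^+ j) = a ((i - j) + (j - i)) by rewrite dM dXa.
set p := h ^+ m; set q := h ^+ (m + m); set x2 := x * q.
have h1 : d 1 q = a (m + m) by [].
have hp1 : d p 1 = a m by rewrite dC.
have hp2 : d p q = a m by rewrite dXa; congr (d 1 (h ^+ _)); lia.
have hx2 : d q x2 = r := hx (m + m)%N.
have dx2 : d x x2 = a (m + m) by rewrite -{1}[x]mulg1 dM.
set u := d p x; set v := d p x2.
have um : (a m <= u + r)%N by rewrite -hp1 /r (dC 1); apply: d_triangle.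
have mu : (u <= a m + r)%N by rewrite -hp1 /r; apply: d_triangle.
have vm : (a m <= v + r)%N by rewrite -hp2 -hx2 (dC q); apply: d_triangle.
set w := d x q.
have wm : (a (m + m) <= w + r)%N by rewrite -h1 /r addnC; apply: d_triangle.
(* The short sides, from 1 to x and from q to x2, are too far from p to keep
   it away from a geodesic from x to x2. *)
have uv : (u + v <= a (m + m) + K + 2 * e)%N.
  have := four_point 1 x q p; have := four_point x x2 q p.
  rewrite -/u -/v -/w -/r dx2 (dC x2 q) hx2 h1 hp1 hp2; lia.
(* The point of the second orbit that is about as far from x as p is. *)
have [i [im iu ui]] : exists i,
    [/\ (i <= m + m)%N, (a i <= u)%N & (u <= a i + K + 2 * e)%N].
  case: (leqP u (a (m + m))) => [/pow_dist_dense[i [? ? ?]]|/ltnW um2].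
    by exists i; split=> //; lia.
  by exists (m + m)%N; split=> //; lia.
exists m, i; rewrite -/p.
have := pow_dist_superadd i (m + m - i); rewrite subnKC //.
have xi1 : d (x * h ^+ i) x = a i by rewrite -{2}[x]mulg1 dM dC.
have xi2 : d (x * h ^+ i) x2 = a (m + m - i).
  by rewrite dp; congr (d 1 (h ^+ _)); lia.
have := four_point x p x2 (x * h ^+ i).
rewrite dx2 (dC x p) -/u -/v xi1 xi2 (dC _ p); lia.
Qed.
End Quasigeodesic.
End HyperbolicMetric.

(** * Word metrics *)

Definition flip_letter (A : Type) (l : A * bool) := (l.1, ~~ l.2).

Section WordMetric.
Local Open Scope group_scope.
Variables (Gamma : groupType) (S : set Gamma).
Implicit Types (w : seq (Gamma * bool)) (g x y z : Gamma).

Lemma word_eval_cons l w : word_eval (l :: w) = letter_eval l * word_eval w.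
Proof. by rewrite /word_eval big_cons. Qed.

Lemma word_eval_cat v w : word_eval (v ++ w) = word_eval v * word_eval w.
Proof. by rewrite /word_eval big_cat. Qed.

Lemma letter_eval_flip (l : Gamma * bool) : letter_eval (flip_letter l) = (letter_eval l)^-1.
Proof. by case: l => s []; rewrite /letter_eval /= ?invgK. Qed.

Lemma word_eval_inv w : word_eval (rev (map (@flip_letter Gamma) w)) = (word_eval w)^-1.
Proof.
elim: w => [|l w IHw]; first by rewrite /word_eval !big_nil invg1.
rewrite map_cons rev_cons -cats1 word_eval_cat IHw [word_eval (l :: w)]word_eval_cons invgM.
by rewrite /word_eval big_seq1 letter_eval_flip.
Qed.

Lemma word_over_cat v w : word_over S v -> word_over S w -> word_over S (v ++ w).
Proof. by move=> Sv Sw l; rewrite mem_cat => /orP[/Sv|/Sw]. Qed.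

Lemma word_over_inv w : word_over S w -> word_over S (rev (map (@flip_letter Gamma) w)).
Proof. by move=> Sw l; rewrite mem_rev => /mapP[m /Sw ? ->]. Qed.

Hypothesis genS : generates S.
Local Notation len := (word_length S).

Lemma word_lengthP g : is_word_length S g (len g).
Proof.
apply: xgetPex.
pose P k := `[< exists w, [/\ word_over S w, word_eval w = g & size w = k] >].
have exP : exists k, P k.
  by have [w Sw wg] := genS g; exists (size w); apply/asboolP; exists w.
exists (ex_minn exP); case: ex_minnP => k /asboolP[w [Sw wg wk]] kmin.
split; first by exists w.
by move=> v Sv vg; apply: kmin; apply/asboolP; exists v.
Qed.

Lemma word_length_le w : word_over S w -> (len (word_eval w) <= size w)%N.
Proof. by move=> Sw; exact: (word_lengthP _).2. Qed.

Lemma shortest_word g :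
  exists w, [/\ word_over S w, word_eval w = g & size w = len g].
Proof. exact: (word_lengthP g).1. Qed.

Lemma word_length1 : len 1 = 0%N.
Proof.
have := @word_length_le [::]; rewrite /word_eval big_nil leqn0 => H.
by apply/eqP; apply: H.
Qed.

Lemma word_lengthV_le g : (len g^-1 <= len g)%N.
Proof.
have [w [Sw <- <-]] := shortest_word g.
rewrite -word_eval_inv (leq_trans (word_length_le (word_over_inv Sw))) //.
by rewrite size_rev size_map.
Qed.

Lemma word_lengthV g : len g^-1 = len g.
Proof.
by apply/eqP; rewrite eqn_leq word_lengthV_le -{1}[g]invgK word_lengthV_le.
Qed.

Lemma word_lengthM x y : (len (x * y) <= len x + len y)%N.
Proof.
have [v [Sv <- <-]] := shortest_word x; have [w [Sw <- <-]] := shortest_word y.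
by rewrite -word_eval_cat -size_cat word_length_le //; exact: word_over_cat.
Qed.

Local Notation d := (word_dist S).

Lemma word_dist1 x : d 1 x = len x.
Proof. by rewrite /word_dist invg1 mul1g. Qed.

Lemma word_distxx x : d x x = 0%N.
Proof. by rewrite /word_dist mulVg word_length1. Qed.

Lemma word_distC x y : d x y = d y x.
Proof. by rewrite /word_dist -word_lengthV invgM invgK. Qed.

Lemma word_distM g x y : d (g * x) (g * y) = d x y.
Proof. by rewrite /word_dist invgM -mulgA mulKg. Qed.

Lemma word_dist_triangle y x z : (d x z <= d x y + d y z)%N.
Proof.
by have := word_lengthM (x^-1 * y) (y^-1 * z); rewrite mulgA mulgK.
Qed.

Lemma word_dist_midpoint g k : (k <= d 1 g)%N ->
  exists2 m, (d m 1 <= k)%N & (d m g <= d 1 g - k)%N.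
Proof.
rewrite word_dist1; have [w [Sw <- <-]] := shortest_word g => kw.
exists (word_eval (take k w)).
  rewrite word_distC word_dist1 (leq_trans (word_length_le _)) ?size_takel //.
  by move=> l /mem_take /Sw.
rewrite -{2}(cat_take_drop k w) word_eval_cat /word_dist mulKg -size_drop.
by apply: word_length_le => l /mem_drop /Sw.
Qed.

Lemma finite_word_balls (finS : finite_set S) R :
  exists L : seq Gamma, forall x, (d 1 x <= R)%N -> x \in L.
Proof.
have [A SA] := (finite_seqP S).1 finS.
pose B := [seq letter_eval l | l <- [seq (s, b) | s <- A, b <- [:: false; true]]].
suff [L LP] : exists L : seq Gamma,
    forall w, word_over S w -> (size w <= R)%N -> word_eval w \in L.
  exists L => x; rewrite word_dist1; have [w [Sw <- <-]] := shortest_word x.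
  exact: LP.
elim: R => [|R [L LP]].
  by exists [:: 1] => -[|l w] // _ _; rewrite /word_eval big_nil inE.
exists (1 :: [seq x * y | x <- B, y <- L]) => -[|l w] Sw.
  by rewrite /word_eval big_nil inE eqxx.
rewrite ltnS => wR; rewrite word_eval_cons in_cons; apply/orP; right.
apply: allpairs_f; last by apply: LP => // m mw; apply: Sw; rewrite in_cons mw orbT.
apply/mapP; exists l => //; case: l Sw => s b Sw; apply: allpairs_f.
  by have := Sw (s, b) (mem_head _ _); rewrite SA.
by case: b {Sw}; rewrite !inE.
Qed.

Lemma four_point_of_gromov : gromov_hyperbolic d -> exists e : nat, forall x y z p,
  (d x z + d p y <= maxn (d x y + d p z) (d y z + d p x) + e)%N.
Proof.
move=> [delta Hd].
have [e de] : exists e : nat, (2%:R * delta <= e%:R :> rat)%R.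
  exists (Num.bound `|2%:R * delta|%R); apply: le_trans (ler_norm _) _.
  exact/ltW/archi_boundP/normr_ge0.
exists e => x y z p; have := Hd p x y z; rewrite /gromov_product.
move: (d p x) (d p y) (d p z) (d x y) (d y z) (d x z) => a b c u v w.
rewrite lerBlDr ge_min => H; rewrite addn_maxl leq_max -!(ler_nat rat) !natrD.
by case/orP: H => H; apply/orP; [left|right]; lra.
Qed.

End WordMetric.

(** The centralizer of a suitable power h of g is covered by finitely many
    cosets of the cyclic group generated by h. Passing to a power of g is what
    makes h push points apart by more than the hyperbolicity constant. *)
Lemma hyperbolic_centralizer (Gamma : groupType) (g : Gamma) :
  hyperbolic_group Gamma -> injective (fun n => g ^+ n)%g ->
  exists2 k, (0 < k)%N & exists L : seq Gamma, forall x, commute x (g ^+ k)%g ->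
    exists m i, ((g ^+ k) ^- m * (x * (g ^+ k) ^+ i))%g \in L.
Proof.
move=> [S [finS genS /four_point_of_gromov[e Hd]]] inj_g.
have balls := finite_word_balls genS finS.
have [k k0 gap] := doubling_gap (word_distxx genS) (word_distC genS)
  (word_dist_triangle genS) (@word_distM _ S) Hd (word_dist_midpoint genS)
  balls (2 * e + 1) inj_g.
exists k => //.
have [L LP] := balls (2 * word_dist S 1 (g ^+ k) + 10 * e)%N.
exists L => x xg.
have := commute_near_pow (word_distxx genS) (word_distC genS)
  (word_dist_triangle genS) (@word_distM _ S) Hd _ xg.
rewrite expg1 -expgnA (mulnC k) => /(_ gap)[m [i mi]]; exists m, i; apply: LP.
by rewrite word_dist1 -[X in (X <= _)%N]/(word_dist S ((g ^+ k) ^+ m) (x * (g ^+ k) ^+ i)).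
Qed.

(** * Integer powers and the transfer to a cyclic central subgroup *)

Section IntegerPowers.
Local Open Scope group_scope.
Variable Gamma : groupType.
Implicit Types (g x y : Gamma) (a b k : int).

Definition zpow g k : Gamma :=
  match k with Posz n => g ^+ n | Negz n => g ^- n.+1 end.

Lemma zpowN_nat g (n : nat) : zpow g (- n%:Z) = g ^- n.
Proof. by case: n => [|n] /=; rewrite ?invg1. Qed.

Lemma zpow_sub g (m n : nat) : zpow g (m%:Z - n%:Z)%R = g ^+ m / g ^+ n.
Proof.
case: (leqP n m) => [nm|/ltnW mn]; first by rewrite subzn //= expgnFr.
by rewrite -opprB subzn // zpowN_nat expgnFr // invgF.
Qed.

Lemma int_subn k : exists m n : nat, k = (m%:Z - n%:Z)%R.
Proof.
case: k => n; first by exists n, 0%N; rewrite subr0.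
by exists 0%N, n.+1; rewrite NegzE sub0r.
Qed.

Lemma commute_zpow x g k : commute x g -> commute x (zpow g k).
Proof. by case: k => n xg /=; [|apply: commuteV]; apply: commuteX. Qed.

Lemma zpowD g a b : zpow g (a + b)%R = zpow g a * zpow g b.
Proof.
have [m [n ->]] := int_subn a; have [p [q ->]] := int_subn b.
rewrite addrACA -opprD -!PoszD (addnC n) !zpow_sub !expgnDr invgM !mulgA.
congr (_ * _); rewrite -!mulgA; congr (_ * _).
by apply: commuteV; apply: commuteX2.
Qed.

Lemma zpow0 g : zpow g 0 = 1. Proof. by []. Qed.

Lemma zpow1 g : zpow g 1 = g. Proof. by []. Qed.

Lemma zpowN g k : zpow g (- k)%R = (zpow g k)^-1.
Proof. by apply/esym/mulg1_eq; rewrite -zpowD subrr. Qed.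

Lemma zpow_conj g x k : zpow g k ^ x = zpow (g ^ x) k.
Proof. by case: k => n; rewrite /= ?conjVg conjXg. Qed.

Lemma zpowV g k : zpow g^-1 k = zpow g (- k)%R.
Proof. by case: k => n; rewrite ?NegzE ?opprK ?zpowN_nat /= expVgn ?invgK. Qed.

Hypothesis tf : torsion_free Gamma.

Lemma zpow_eq1 g k : g <> 1 -> zpow g k = 1 -> k = 0%R.
Proof.
move=> g1 gk; apply/eqP; apply: contra_notT g1 => k0.
apply: (tf (k := `|k|%N)); first by rewrite absz_gt0.
by case: k gk {k0} => n //= /eqP; rewrite invg_eq1 => /eqP.
Qed.

Lemma zpow_inj g : g <> 1 -> injective (zpow g).
Proof.
move=> g1 a b ab; apply/eqP; rewrite -subr_eq0; apply/eqP/(zpow_eq1 g1).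
by rewrite zpowD ab zpowN mulgV.
Qed.
End IntegerPowers.

(** Suppose that the centralizer C of h is covered by finitely many cosets of
    the central subgroup generated by h. For coset representatives t, the map
    sending x to the sum of the exponents of h in the elements t x is the
    transfer homomorphism from C to the infinite cyclic group generated by h.
    It is nonzero on h, and some power of each x is a power of h; so its kernel
    is torsion, hence trivial. *)
Section Transfer.
Local Open Scope group_scope.
Variables (Gamma : groupType) (h : Gamma) (L : seq Gamma).
Hypothesis tf : torsion_free Gamma.
Hypothesis h1 : h <> 1.
Hypothesis HL : forall x, commute x h -> exists m i, h ^- m * (x * h ^+ i) \in L.
Implicit Types (x y z t : Gamma) (k : int).

(* As a function of the coset of y alone, the choice is constant on cosets. *)
Let coset_repr y : Gamma := xget 1 [set z | exists k, y = z * zpow h k].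

Let reprP y : exists k, y = coset_repr y * zpow h k.
Proof.
rewrite /coset_repr; case: xgetP => [x -> //|H].
by case: (H y); exists 0%R; rewrite mulg1.
Qed.

Let repr_mul y k : coset_repr (y * zpow h k) = coset_repr y.
Proof.
rewrite /coset_repr; congr (xget 1 _); apply/seteqP; split=> z /= [j].
  by move=> E; exists (j - k)%R; rewrite zpowD mulgA -E zpowN mulgK.
by move=> ->; exists (j + k)%R; rewrite zpowD mulgA.
Qed.

Let expo y : int := projT1 (cid (reprP y)).

Let expoP y : y = coset_repr y * zpow h (expo y).
Proof. exact: projT2 (cid (reprP y)). Qed.

Let expoN y : y * zpow h (- expo y)%R = coset_repr y.
Proof. by rewrite {1}[y]expoP -mulgA -zpowD subrr mulg1. Qed.

Let expo_unique y k : y = coset_repr y * zpow h k -> expo y = k.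
Proof. by rewrite {1}[y]expoP => /mulgI /(zpow_inj tf h1). Qed.

Let commute_repr y : commute y h -> commute (coset_repr y) h.
Proof.
move=> yh; have [k] := reprP y; move: (coset_repr y) => c E.
rewrite -(mulgK (zpow h k) c) -E; apply/commute_sym/commuteM.
  exact/commute_sym.
exact/commuteV/commute_zpow.
Qed.

Let reprs := undup [seq coset_repr y | y <- L & `[< commute y h >]].

Let mem_reprs y : commute y h -> coset_repr y \in reprs.
Proof.
move=> yh; have [m [i yL]] := HL yh.
have E : h ^- m * (y * h ^+ i) = y * zpow h (i%:Z - m%:Z)%R.
  have C : commute (y * h ^+ i) (h ^- m).
    apply/commuteV/commuteX/commute_sym/commuteM; first exact/commute_sym.
    exact: commuteX.
  by rewrite -C zpow_sub mulgA.
rewrite mem_undup -(repr_mul y (i%:Z - m%:Z)); apply/map_f.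
rewrite mem_filter -E yL andbT; apply/asboolP; rewrite E.
apply/commute_sym/commuteM; first exact/commute_sym.
exact: commute_zpow.
Qed.

Let reprs_commute t : t \in reprs -> commute t h.
Proof.
rewrite mem_undup => /mapP[y]; rewrite mem_filter => /andP[/asboolP yh _] ->.
exact: commute_repr.
Qed.

Let reprs_fix t : t \in reprs -> coset_repr t = t.
Proof.
rewrite mem_undup => /mapP[y _ ->].
by rewrite -[LHS](repr_mul _ (expo y)) -expoP.
Qed.

Let transfer x : int := (\sum_(t <- reprs) expo (t * x))%R.

(** Representatives that x sends to the same coset are themselves in the same
    coset, because x commutes with the powers of h. *)
Let reprs_perm x : commute x h ->
  perm_eq [seq coset_repr (t * x) | t <- reprs] reprs.
Proof.
move=> xh; have xhk k : commute x (zpow h k) by exact: commute_zpow.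
have U : uniq [seq coset_repr (t * x) | t <- reprs].
  rewrite map_inj_in_uniq ?undup_uniq // => t u tF uF E.
  have : t * x = u * zpow h (expo (t * x) - expo (u * x)) * x.
    by rewrite -mulgA -xhk mulgA addrC zpowD mulgA expoN -E -expoP.
  move=> /mulIg tu; rewrite -(reprs_fix tF) -(reprs_fix uF) {1}tu.
  exact: repr_mul.
have sub : {subset [seq coset_repr (t * x) | t <- reprs] <= reprs}.
  move=> _ /mapP[t /reprs_commute th ->]; apply/mem_reprs/commute_sym/commuteM.
    exact/commute_sym.
  exact/commute_sym.
have [_ eqm] := uniq_min_size U sub (eq_leq (esym (size_map _ _))).
exact: uniq_perm U (undup_uniq _) eqm.
Qed.

Let transferM x y : commute x h -> commute y h ->
  transfer (x * y) = (transfer x + transfer y)%R.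
Proof.
move=> xh yh; rewrite addrC /transfer.
rewrite -[X in (_ = X + _)%R](perm_big _ (reprs_perm xh)) big_map.
rewrite -big_split /=; apply: eq_bigr => t _; apply: expo_unique.
have E : t * (x * y) = coset_repr (t * x) * y * zpow h (expo (t * x)).
  by rewrite -mulgA (commute_zpow _ yh) !mulgA -expoP.
rewrite [in RHS]E repr_mul zpowD [RHS]mulgA -expoP; exact: E.
Qed.

Let transfer_zpow k : transfer (zpow h k) = (k * (size reprs)%:Z)%R.
Proof.
transitivity (\sum_(t <- reprs) k)%R.
  rewrite /transfer !big_seq; apply: eq_bigr => t tF; apply: expo_unique.
  by rewrite repr_mul reprs_fix.
by rewrite big_const_seq count_predT iter_addr_0 -mulr_natr natz.
Qed.

Let transfer_inj x : commute x h -> transfer x = 0%R -> x = 1.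
Proof.
move=> xh Vx; have hx j : commute (x ^+ j) h by exact/commute_sym/commuteX/commute_sym.
have VX j : transfer (x ^+ j) = 0%R.
  elim: j => [|j IHj]; first by rewrite expg0 -(zpow0 h) transfer_zpow mul0r.
  by rewrite expgS transferM // Vx IHj.
have [a [b [ab E]]] :=
  seq_pigeonhole (fun j (_ : (j <= size reprs)%N) => mem_reprs (hx j)).
have xab : x ^+ (b - a) = zpow h (expo (x ^+ b) - expo (x ^+ a)).
  apply: (mulgI (x ^+ a)); rewrite -expgnDr subnKC 1?ltnW // [LHS]expoP.
  by rewrite addrC zpowD mulgA expoN E.
have := VX (b - a)%N; rewrite xab transfer_zpow => /eqP; rewrite mulf_eq0.
have -> : ((size reprs)%:Z == 0)%R = false.
  by have := mem_reprs (commute_sym (commute1 h)); case: reprs.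
rewrite orbF => /eqP k0; apply: (tf (k := (b - a)%N)); first by rewrite subn_gt0.
by rewrite xab k0.
Qed.

Lemma centralizer_embeds_int : exists V : Gamma -> int,
  (forall x y, commute x h -> commute y h -> V (x * y) = (V x + V y)%R) /\
  (forall x, commute x h -> V x = 0%R -> x = 1).
Proof. by exists transfer; split. Qed.
End Transfer.

(** Subgroups P of Gamma on which V restricts to an injective homomorphism to
    the integers; outside P nothing is known of V. *)
Section EmbeddedInInt.
Local Open Scope group_scope.
Variables (Gamma : groupType) (P : set Gamma) (V : Gamma -> int).
Hypothesis P1 : P 1.
Hypothesis PM : forall x y, P x -> P y -> P (x * y).
Hypothesis PV : forall x, P x -> P x^-1.
Hypothesis VM : forall x y, P x -> P y -> V (x * y) = (V x + V y)%R.
Hypothesis Vinj : forall x, P x -> V x = 0%R -> x = 1.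
Implicit Types (x y : Gamma) (k : int).

Lemma int_val1 : V 1 = 0%R.
Proof. by apply: (@addrI _ (V 1)); rewrite -VM // mulg1 addr0. Qed.

Lemma int_valV x : P x -> V x^-1 = (- V x)%R.
Proof.
move=> Px; apply: (@addrI _ (V x)); rewrite -VM //; last exact: PV.
by rewrite mulgV int_val1 subrr.
Qed.

Lemma closed_zpow x k : P x -> P (zpow x k).
Proof.
move=> Px; have PX n : P (x ^+ n) by elim: n => // n IHn; rewrite expgS; apply: PM.
by case: k => n /=; [|apply: PV]; apply: PX.
Qed.

Lemma int_val_zpow x k : P x -> V (zpow x k) = (k * V x)%R.
Proof.
move=> Px; have VX (n : nat) : V (x ^+ n) = (n%:Z * V x)%R.
  elim: n => [|n IHn]; first by rewrite expg0 int_val1 mul0r.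
  rewrite expgS VM // ?IHn; last exact: (@closed_zpow x n).
  by rewrite -[n.+1]add1n PoszD mulrDl mul1r.
case: k => n; first exact: VX.
rewrite /= int_valV; last exact: (@closed_zpow x n.+1).
by rewrite VX NegzE mulNr.
Qed.

Lemma int_val_inj x y : P x -> P y -> V x = V y -> x = y.
Proof.
move=> Px Py Vxy; apply/divg1_eq/Vinj; first exact/PM/PV.
by rewrite VM ?int_valV ?Vxy ?subrr //; apply: PV.
Qed.

(** The positive value of V that is least generates the image of P, by
    Euclidean division. *)
Lemma int_embedded_cyclic : exists2 t, P t & forall x, P x -> exists k, x = zpow t k.
Proof.
pose Q n := `[< exists t, [/\ P t, V t = Posz n & (0 < n)%N] >].
case: (pselect (exists n, Q n)) => [exQ|noQ].
  case: (ex_minnP exQ) => n /asboolP[t [Pt Vt n0]] nmin.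
  exists t => // x Px; exists (V x %/ n)%Z; set q := (V x %/ n)%Z.
  apply/divg1_eq/Vinj; first by apply/PM => //; apply/PV/closed_zpow.
  have Pr : P (x / zpow t q) by apply/PM => //; apply/PV/closed_zpow.
  have Vr : V (x / zpow t q) = (V x %% n)%Z.
    rewrite VM // ?int_valV ?int_val_zpow //; try exact: closed_zpow; last first.
      by apply/PV/closed_zpow.
    by rewrite Vt {1}(divz_eq (V x) n) -/q addrC addKr.
  have n0' : (0 < n%:Z)%R by [].
  rewrite Vr; move: (modz_ge0 (V x) (lt0r_neq0 n0')) (ltz_pmod (V x) n0') Vr.
  case: (V x %% n)%Z => // -[//|m] _ mn Vr.
  suff /nmin : Q m.+1 by rewrite leqNgt (_ : (m.+1 < n)%N).
  by apply/asboolP; exists (x / zpow t q).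
exists 1 => // x Px; exists 0%R; apply: Vinj => //; apply/eqP.
apply: contra_notT noQ => Vx0.
have [y Py Vy] : exists2 y, P y & (0 < V y)%R.
  case: (ltgtP (V x) 0%R) Vx0 => // Vx _; last by exists x.
  by exists x^-1; rewrite ?int_valV ?oppr_gt0 //; apply: PV.
exists `|V y|%N; apply/asboolP; exists y; split=> //; first by rewrite gtz0_abs.
by rewrite absz_gt0 gt_eqF.
Qed.
End EmbeddedInInt.

(** * Centralizers in torsion-free hyperbolic groups *)

Section CyclicFree.
Local Open Scope group_scope.
Variable Gamma : groupType.
Hypothesis tf : torsion_free Gamma.

Lemma word_eval_nseq (t : Gamma) b n :
  word_eval (nseq n (t, b)) = zpow t (if b then - n%:Z else n%:Z)%R.
Proof.
elim: n => [|n IHn]; first by rewrite /word_eval big_nil; case: b.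
rewrite /= word_eval_cons IHn /letter_eval /=; case: b {IHn}.
  by rewrite -{1}[t]zpow1 -zpowN -zpowD; congr zpow; lia.
by rewrite -{1}[t]zpow1 -zpowD.
Qed.

Lemma reduced_one_letter (t : Gamma) w : word_over [set t] w -> reduced w ->
  exists b, w = nseq (size w) (t, b).
Proof.
elim: w => [|[s b] w IHw] Sw; first by exists true.
have st : s = t := Sw _ (mem_head _ _); subst s.
have Sw' : word_over [set t] w by move=> l lw; apply: Sw; rewrite in_cons lw orbT.
case: w IHw Sw' {Sw} => [|[s c] w] IHw Sw' /=; first by exists b.
move=> /andP[tb red]; have [c' /= [st cc' wE]] := IHw Sw' red; subst s.
have bc : b = c by apply/eqP; move: tb; rewrite /= eqxx negbK.
by exists c'; rewrite bc cc' -wE.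
Qed.

Lemma cyclic_free (t : Gamma) : (forall x, exists k, x = zpow t k) -> free_group Gamma.
Proof.
move=> tgen; have [t1|/eqP t1] := eqVneq t 1.
  exists set0%classic => g; have -> : g = 1.
    have [k ->] := tgen g; rewrite t1; case: k => n /=; by rewrite expg1n ?invg1.
  exists [::]; split=> [|w [Sw _ _]]; first by split=> //; rewrite /word_eval big_nil.
  by case: w Sw => // l w /(_ l (mem_head _ _)).
exists [set t]%classic => g; have [k ->] := tgen g.
have [b [n kE]] : exists b, exists n : nat, k = (if b then - n%:Z else n%:Z)%R.
  by case: k => n; [exists false, n|exists true, n.+1; rewrite NegzE].
exists (nseq n (t, b)); split.
  split; last by rewrite word_eval_nseq -kE.
    by move=> l /nseqP[-> _].
  rewrite /reduced; case: n {kE} => //= n; elim: n => //= n ->.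
  by rewrite !eqxx.
move=> w [Sw /(reduced_one_letter Sw)[c wE]].
rewrite wE word_eval_nseq => /(zpow_inj tf t1); rewrite kE.
case: (posnP (size w)) => [->|w0].
  by case: n kE => // n kE; case: b c {kE wE} => -[] //=; lia.
move=> E; have -> : n = size w by case: b c E {kE wE} => -[]; lia.
by congr (nseq _ (_, _)); case: b c E {kE wE} => -[] //; lia.
Qed.
End CyclicFree.

Section HyperbolicAlgebra.
Local Open Scope group_scope.
Variable Gamma : groupType.
Hypothesis tf : torsion_free Gamma.
Hypothesis hyp : hyperbolic_group Gamma.
Implicit Types (x y g c : Gamma).

Lemma torsion_free_pow_inj g : g <> 1 -> injective (fun n => g ^+ n).
Proof. by move=> g1 i j /(@zpow_inj _ tf g g1 (Posz i) (Posz j)) []. Qed.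

Lemma centralizer_of_power_in_int g : g <> 1 -> exists2 k, (0 < k)%N &
  exists V : Gamma -> int,
  (forall x y, commute x (g ^+ k) -> commute y (g ^+ k) ->
     V (x * y) = (V x + V y)%R) /\
  (forall x, commute x (g ^+ k) -> V x = 0%R -> x = 1).
Proof.
move=> g1; have [k k0 [L HL]] := hyperbolic_centralizer hyp (torsion_free_pow_inj g1).
exists k => //; apply: centralizer_embeds_int HL => //.
by move=> gk; apply: g1; apply: tf gk.
Qed.

Lemma centralizerM (h : Gamma) x y : commute x h -> commute y h -> commute (x * y) h.
Proof. by move=> xh yh; apply/commute_sym/commuteM; apply: commute_sym. Qed.

Lemma centralizerV (h : Gamma) x : commute x h -> commute x^-1 h.
Proof. by move=> xh; apply/commute_sym/commuteV/commute_sym. Qed.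

(** The centralizer of a power of g contains x and y, and embeds in the
    integers. *)
Lemma commuting_transitive g x y : g <> 1 -> commute x g -> commute y g -> commute x y.
Proof.
move=> g1 xg yg; have [k _ [V [VM Vinj]]] := centralizer_of_power_in_int g1.
have xh : commute x (g ^+ k) by apply: commuteX.
have yh : commute y (g ^+ k) by apply: commuteX.
have M := @centralizerM (g ^+ k).
apply: (int_val_inj (P := [set z | commute z (g ^+ k)]) _ M
  (@centralizerV _) VM Vinj) => //=.
- exact/commute_sym/commute1.
- exact: M.
- exact: M.
- by rewrite !VM // addrC.
Qed.

(** The subgroup N lies in the centralizer of c, hence is generated by some t,
    and every element of the group conjugates t to itself or to its inverse.
    The latter cannot happen: x conjugates some h = t^q to h^-1 and x^2 commutes
    with h, so that some power of x^2 is a power of h, conjugated by x both to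
    itself and to its inverse. So the whole group centralizes h and is cyclic. *)
Lemma normal_centralizer_free (N : set Gamma) n0 c :
  N 1 -> (forall x y, N x -> N y -> N (x * y)) -> (forall x, N x -> N x^-1) ->
  (forall x y, N x -> N (x ^ y)) ->
  N n0 -> n0 <> 1 -> c <> 1 -> (forall x, N x -> commute x c) ->
  free_group Gamma.
Proof.
move=> N1 NM NV NJ Nn0 n01 c1 Nc.
have [k k0 [V [VM Vinj]]] := centralizer_of_power_in_int c1.
have NC x : N x -> commute x (c ^+ k) by move=> /Nc /commuteX.
have VMN x y : N x -> N y -> V (x * y) = (V x + V y)%R.
  by move=> /NC xh /NC yh; apply: VM.
have VinjN x : N x -> V x = 0%R -> x = 1 by move=> /NC; apply: Vinj.
have [t Nt tgen] := int_embedded_cyclic N1 NM NV VMN VinjN.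
have t1 : t <> 1.
  move=> t1; have [j E] := tgen _ Nn0; apply: n01; rewrite E t1.
  by case: j {E} => j /=; rewrite expg1n ?invg1.
have Vt0 : V t != 0%R by apply/eqP => Vt; apply: t1; apply: VinjN.
have tJ x : t ^ x = t \/ t ^ x = t^-1.
  have [a aE] := tgen _ (NJ t x Nt); have [b bE] := tgen _ (NJ t x^-1 Nt).
  have tE : t = zpow (t ^ x) b by rewrite -zpow_conj -bE -conjgM mulVg conjg1.
  have : V t = (b * (a * V t))%R.
    by rewrite {1}tE (int_val_zpow N1 NM NV VMN) ?aE ?(int_val_zpow N1 NM NV VMN) //;
      rewrite -aE; apply: NJ.
  rewrite mulrA -{1}[V t]mul1r => /(mulIf Vt0) ba.
  have : (`|b| * `|a| == 1)%N by rewrite -abszM -ba.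
  rewrite muln_eq1 => /andP[_ /eqP a1].
  have : a = 1%R \/ a = (-1)%R by lia.
  by rewrite aE; case=> ->; [left|right].
have [q q0 [W [WM Winj]]] := centralizer_of_power_in_int t1.
set h := t ^+ q in WM Winj.
have h1 : h <> 1 by move=> /(tf q0).
have C1 : commute 1 h by apply/commute_sym/commute1.
have CM := @centralizerM h; have CV := @centralizerV h.
have hC x : commute x h.
  have [tx|tx] := tJ x.
    by apply/commute_sym; rewrite /commute conjgC /h conjXg tx.
  have hx : h ^ x = h^-1 by rewrite /h conjXg tx expVgn.
  have xxh : commute (x * x) h.
    apply/commute_sym; rewrite /commute conjgC; congr (_ * _).
    by rewrite conjgM hx conjVg hx invgK.
  pose v := W h; pose l := W (x * x).
  have E : zpow (x * x) v = zpow h l.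
    have hh : commute h h by [].
    have Z := int_val_zpow (P := [set z | commute z h]) C1 CM CV WM.
    have cl := closed_zpow (P := [set z | commute z h]) C1 CM CV.
    apply: (int_val_inj (P := [set z | commute z h]) C1 CM CV WM Winj).
    - exact: cl.
    - exact: cl.
    - by rewrite !Z // mulrC.
  have : zpow h l = zpow h (- l)%R.
    rewrite -zpowV -hx -zpow_conj -E zpow_conj; congr zpow.
    by rewrite conjgE !mulgA mulVg mul1g.
  move=> /(zpow_inj tf h1) ll; have l0 : l = 0%R by lia.
  have x1 : x * x = 1 by apply: Winj.
  have -> : x = 1 by apply: (tf (k := 2)); rewrite ?expg2.
  exact: C1.
have [] := int_embedded_cyclic (P := setT) (V := W) => //.
- by move=> x y _ _; apply: WM; apply: hC.
- by move=> x _; apply: Winj; apply: hC.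
by move=> s _ sgen; apply: (cyclic_free tf (t := s)) => x; apply: sgen.
Qed.
End HyperbolicAlgebra.

(** * Simple paths in trees *)

Section SimplePaths.
Variable T : graph.
Hypothesis connT : connected_graph T.
Hypothesis acycT : acyclic_graph T.
Implicit Types (x y u v : T) (p q : seq T).

Definition simple_path x p y :=
  [/\ path (@adj T) x p, uniq (x :: p) & last x p = y].

(** Otherwise the edge would close the path to a circuit. *)
Lemma simple_path_edge x p y : simple_path x p y -> adj x y -> p = [:: y].
Proof.
move=> [xp up <-] xy.
have /acycT : ucycle (@adj T) (x :: p).
  by rewrite /ucycle up andbT /cycle rcons_path xp adj_sym.
by case: p xp up xy => [|z [|? ?]] //=; rewrite adj_irr.
Qed.

(** If v is already on the path, it is its last vertex but one: what follows v
    is a simple path between adjacent vertices. *)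
Lemma simple_path_step x p u v : simple_path x p u -> adj u v ->
  simple_path x (rcons p v) v \/
  exists2 p1, p = rcons p1 u & simple_path x p1 v.
Proof.
move=> [xp up pu] uv; have [vp|vp] := boolP (v \in x :: p); last first.
  left; split; first by rewrite rcons_path xp pu.
    by rewrite -rcons_cons rcons_uniq vp.
  by rewrite last_rcons.
right; case/splitPl: vp xp up pu => p1 p2 p1v.
rewrite cat_path last_cat -cat_cons cat_uniq p1v => /andP[xp1 vp2].
move=> /and3P[up1 /hasPn disj up2] p2u; exists p1 => //.
suff -> : p2 = [:: u] by rewrite cats1.
apply: (@simple_path_edge v); last by rewrite adj_sym.
split=> //=; rewrite up2 andbT; apply/negP => /disj /=.
by rewrite -p1v mem_last.
Qed.

(** Follow p and q backwards from v along the last edge of p. If q did not end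
    with that edge, then q followed by it would be a simple path to the vertex
    before v on p, hence equal to what remains of p, which avoids v. *)
Lemma simple_path_unique x p q v : simple_path x p v -> simple_path x q v -> p = q.
Proof.
elim/last_ind: p q v => [|p w IHp] q v.
  move=> [_ _ /= <-] [_ /andP[xq _] qx]; case: q xq qx => // y q xq /= qx.
  by rewrite -qx mem_last in xq.
move=> [+ + +]; rewrite rcons_path last_rcons -rcons_cons rcons_uniq => /andP[xp pw].
move=> /andP[wp up] <-{v} qw.
have [q1|[q1 -> q1p]] := simple_path_step qw (etrans (adj_sym _ _) pw).
  have E := IHp _ _ (And3 xp up erefl) q1; case/negP: wp.
  rewrite E -rcons_cons mem_rcons in_cons.
  by case: qw => _ _ <-; rewrite mem_last orbT.
by congr rcons; apply: IHp q1p.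
Qed.

Variable v0 : T.

Lemma simple_path_exists v : exists p, simple_path v0 p v.
Proof.
have [p v0p <-] := connT v0 v.
by case/shortenP: v0p => q v0q uq _; exists q.
Qed.

(** The only simple path, hence also the shortest path. *)
Definition geodesic v : seq T := projT1 (cid (simple_path_exists v)).

Lemma geodesicP v : simple_path v0 (geodesic v) v.
Proof. exact: projT2 (cid (simple_path_exists v)). Qed.

Lemma geodesicE p v : simple_path v0 p v -> geodesic v = p.
Proof. by move=> pv; apply: simple_path_unique pv; apply: geodesicP. Qed.

Lemma geodesic_base : geodesic v0 = [::].
Proof. exact: geodesicE. Qed.

Lemma geodesic_adj u v : adj u v ->
  geodesic v = rcons (geodesic u) v \/ geodesic u = rcons (geodesic v) u.
Proof.
move=> uv; have [/geodesicE|[p E /geodesicE pv]] := simple_path_step (geodesicP u) uv.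
  by left.
by right; rewrite pv.
Qed.

Lemma geodesic_pred v : v <> v0 ->
  exists2 u, adj u v & size (geodesic u) < size (geodesic v).
Proof.
have := geodesicP v; elim/last_ind: (geodesic v) => [[_ _ /= ->]|p w _] //.
move=> [+ + +] _; rewrite rcons_path last_rcons -rcons_cons rcons_uniq.
move=> /andP[xp pw] /andP[_ up] <-; exists (last v0 p) => //.
by rewrite (geodesicE (And3 xp up erefl)) size_rcons.
Qed.
End SimplePaths.

(** * Free reduction *)

Section FreeReduction.
Variable A : eqType.
Implicit Types (l m : A * bool) (s : seq (A * bool)).

(** The relation between consecutive letters that defines reduced words. *)
Definition compatible l m := ~~ ((l.1 == m.1) && (l.2 != m.2)).

Lemma flip_letterK : involutive (@flip_letter A).
Proof. by case=> a b; rewrite /flip_letter /= negbK. Qed.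

Lemma compatibleE l m : compatible l m = (m != flip_letter l).
Proof.
case: l m => [a b] [c d]; rewrite /compatible /flip_letter xpair_eqE /= (eq_sym c).
by case: b d => -[].
Qed.

Lemma compatible_sym l m : compatible l m = compatible m l.
Proof. by rewrite !compatibleE -(inj_eq (inv_inj flip_letterK)) flip_letterK eq_sym. Qed.

(** A reduced word is kept with its last letter at the head, and multiplied by
    a letter l on its right with at most one cancellation. *)
Definition push l s :=
  if s is m :: s' then if m == flip_letter l then s' else l :: s else [:: l].

Lemma push_sorted l s : sorted compatible s -> sorted compatible (push l s).
Proof.
case: s => //= m s ms; case: ifP => [_|ml]; first exact: path_sorted ms.
by rewrite /= ms compatibleE ml.
Qed.

(** Cancelling twice in a row would require a sequence that is not reduced. *)
Lemma push_flip_letter l s : sorted compatible s -> push (flip_letter l) (push l s) = s.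
Proof.
case: s => [|m s] /=; first by rewrite flip_letterK eqxx.
case: ifP => [/eqP -> /=|ml _ /=]; last by rewrite flip_letterK eqxx.
by case: s => //= n s /andP[+ _]; rewrite compatibleE => /negbTE ->.
Qed.
End FreeReduction.

Lemma push_mem (A : eqType) (P : A * bool -> Prop) l s :
  P l -> {in s, forall m, P m} -> {in push l s, forall m, P m}.
Proof.
case: s => [|m s] Pl Ps /=; first by move=> n; rewrite inE => /eqP ->.
case: ifP => _ n nps; first by apply: Ps; rewrite in_cons nps orbT.
by move: nps; rewrite in_cons => /orP[/eqP -> //|]; apply: Ps.
Qed.

(** * Groups acting freely on trees *)

(** A group without torsion that acts freely on a tree is free. Cut the tree
    into connected tiles that the group permutes simply transitively. A
    free basis consists of the elements that carry one fixed tile to an adjacent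
    one, one chosen from each pair of inverses: since the tree has no circuits,
    the sequence of tiles that a simple path meets is the reduced word of the
    element that carries the first tile to the last. *)
Section FreeAction.
Local Open Scope group_scope.
Variables (Gamma : groupType) (T : graph) (act : Gamma -> T -> T).
Hypothesis tf : torsion_free Gamma.
Hypothesis connT : connected_graph T.
Hypothesis acycT : acyclic_graph T.
Hypothesis act1 : forall x, act 1 x = x.
Hypothesis actM : forall g h x, act (g * h) x = act g (act h x).
Hypothesis act_adj : forall g x y, adj (act g x) (act g y) = adj x y.
Hypothesis act_free : forall g x, act g x = x -> g = 1.
Variable v0 : T.
Implicit Types (g h l : Gamma) (u v w x y : T).

Let actK g : cancel (act g) (act g^-1).
Proof. by move=> x; rewrite -actM mulVg act1. Qed.

Let actKV g : cancel (act g^-1) (act g).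
Proof. by move=> x; rewrite -actM mulgV act1. Qed.

Let act_inj g h x : act g x = act h x -> g = h.
Proof.
move=> E; have := actK h x; rewrite -E -actM => /act_free /mulg1_eq.
by rewrite invgK.
Qed.

Local Notation P := (geodesic connT v0).
Let depth v := size (P v).

(** The level of v is the least distance from v0 to the orbit of v. *)
Let lev_ex v : exists k, `[< exists g, depth (act g v) = k >].
Proof. by exists (depth (act 1 v)); apply/asboolP; exists 1. Qed.

Let lev v := ex_minn (lev_ex v).

Let levP v : exists g, depth (act g v) = lev v.
Proof. by rewrite /lev; case: ex_minnP => k /asboolP. Qed.

Let lev_le g v : (lev v <= depth (act g v))%N.
Proof.
by rewrite /lev; case: ex_minnP => k _; apply; apply/asboolP; exists g.
Qed.

Let lev_act g v : lev (act g v) = lev v.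
Proof.
have le h w : (lev (act h w) <= lev w)%N.
  by have [k <-] := levP w; have := lev_le (k * h^-1) (act h w); rewrite actM actK.
by apply/eqP; rewrite eqn_leq le -{1}(actK g v) le.
Qed.

Let lev_base : lev v0 = 0%N.
Proof.
apply/eqP; rewrite -leqn0; have := lev_le 1 v0.
by rewrite act1 /depth geodesic_base.
Qed.

Let lev0 v : lev v = 0%N -> exists g, v = act g v0.
Proof.
move=> v00; have [g] := levP v; rewrite v00 => /size0nil Pg.
have [_ _] := geodesicP connT v0 (act g v); rewrite Pg /= => E.
by exists g^-1; rewrite E actK.
Qed.

Let lower_neighbour v : exists u,
  if lev v == 0%N then u = v else adj u v && (lev u < lev v)%N.
Proof.
case: eqP => [|/eqP lv]; first by exists v.
have [g gv] := levP v.
have gv0 : act g v <> v0.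
  by move=> E; move: lv; rewrite -gv E /depth geodesic_base.
have [u uv du] := geodesic_pred connT acycT gv0.
exists (act g^-1 u); rewrite -{1}(actK g v) act_adj uv /=.
rewrite (leq_ltn_trans (lev_le g _)) // actKV -gv; exact: du.
Qed.

Let orbit_repr v : T := xget v0 [set w | exists g, v = act g w]%classic.

Let orbit_reprP v : exists g, v = act g (orbit_repr v).
Proof.
rewrite /orbit_repr; case: xgetP => [w -> //|H].
by case: (H v); exists 1; rewrite act1.
Qed.

Let orbit_repr_act g v : orbit_repr (act g v) = orbit_repr v.
Proof.
rewrite /orbit_repr; congr (xget v0 _); apply/seteqP; split=> w /= [h E].
  by exists (g^-1 * h); rewrite actM -E actK.
by exists (g * h); rewrite actM -E.
Qed.

(** Well defined, and thus equivariant, because the action is free. *)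
Let pos v : Gamma := projT1 (cid (orbit_reprP v)).

Let posP v : v = act (pos v) (orbit_repr v).
Proof. exact: projT2 (cid (orbit_reprP v)). Qed.

Let pos_act g v : pos (act g v) = g * pos v.
Proof.
apply: (@act_inj _ _ (orbit_repr v)); rewrite actM -posP.
by rewrite -(orbit_repr_act g v) -posP.
Qed.

(** Neighbours of lower level are chosen on orbit representatives and then
    transported, so that the choice is equivariant. *)
Let parent v := act (pos v) (projT1 (cid (lower_neighbour (orbit_repr v)))).

Let parent_act g v : parent (act g v) = act g (parent v).
Proof. by rewrite /parent orbit_repr_act pos_act actM. Qed.

Let parentP v : if lev v == 0%N then parent v = v
  else adj (parent v) v && (lev (parent v) < lev v)%N.
Proof.
have lc : lev (orbit_repr v) = lev v by rewrite {2}[v]posP lev_act.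
rewrite /parent; case: cid => u /=; rewrite lc; case: ifP => _.
  by move=> ->; rewrite -posP.
by move=> /andP[uc lu]; rewrite lev_act lu andbT {2}[v]posP act_adj.
Qed.

(** At level 0 the parent of v is v itself, so any larger number of iterations
    leads to the same vertex. *)
Let root v := iter (lev v) parent v.

Let iter_parent_lev0 k v : lev v = 0%N -> iter k parent v = v.
Proof.
move=> lv; elim: k => // k IHk; rewrite iterS IHk.
by have := parentP v; rewrite lv eqxx.
Qed.

Let iter_parent_lev k v : (lev v <= k)%N -> lev (iter k parent v) = 0%N.
Proof.
elim: k v => [|k IHk] v lk; first by apply/eqP; rewrite -leqn0.
rewrite iterSr; apply: IHk; have := parentP v; case: eqP => [l0 ->|_]; first by rewrite l0.
by move=> /andP[_ lp]; rewrite -ltnS (leq_trans lp).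
Qed.

Let root_iter k v : (lev v <= k)%N -> iter k parent v = root v.
Proof.
move=> lk; rewrite -(subnK lk) iterD iter_parent_lev0 //.
exact: iter_parent_lev.
Qed.

Let root_parent v : root (parent v) = root v.
Proof.
have lp : (lev (parent v) <= lev v)%N.
  by have := parentP v; case: eqP => [_ -> //|_ /andP[_ /ltnW]].
by rewrite -(root_iter lp) -iterSr root_iter.
Qed.

Let root_act g v : root (act g v) = act g (root v).
Proof.
rewrite /root lev_act; elim: (lev v) => // k IHk.
by rewrite !iterS IHk parent_act.
Qed.

Let root_orbit v : exists g, root v = act g v0.
Proof. by apply: lev0; apply: iter_parent_lev. Qed.

(** The tile indexed by g consists of the vertices whose root is the translate
    of v0 by g. Following the parents connects each of them to that root within
    the tile. *)
Let tile v : Gamma := projT1 (cid (root_orbit v)).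

Let tileP v : root v = act (tile v) v0.
Proof. exact: projT2 (cid (root_orbit v)). Qed.

Let tile_act g v : tile (act g v) = g * tile v.
Proof. by apply: (@act_inj _ _ v0); rewrite actM -!tileP root_act. Qed.

Let tile_base : tile v0 = 1.
Proof. by apply: (@act_free _ v0); rewrite -tileP /root lev_base. Qed.

Let tile_parent v : tile (parent v) = tile v.
Proof. by apply: (@act_inj _ _ v0); rewrite -!tileP root_parent. Qed.

(** The label of an edge is the element that carries one fixed tile to its
    neighbour, for a translate of the edge; it is 1 inside a tile. *)
Let label u v := (tile u)^-1 * tile v.

Let label_sym u v : label v u = (label u v)^-1.
Proof. by rewrite /label invgM invgK. Qed.

Let label_act g u v : label (act g u) (act g v) = label u v.
Proof. by rewrite /label !tile_act invgM -mulgA mulKg. Qed.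

Let edge_label l := l <> 1 /\ exists u v, adj u v /\ label u v = l.

Let edge_labelV l : edge_label l -> edge_label l^-1.
Proof.
move=> [l1 [u [v [uv E]]]]; split; first by move/eqP; rewrite invg_eq1 => /eqP.
by exists v, u; rewrite adj_sym label_sym E.
Qed.

Let no_involution l : l <> 1 -> l^-1 <> l.
Proof.
move=> l1 E; apply: l1; apply: (tf (k := 2)) => //.
by rewrite expg2 -{1}E mulVg.
Qed.

(** One element of the pair formed by l and its inverse, the same for both. *)
Let orient l : Gamma := xget 1 [set z | z = l \/ z = l^-1]%classic.

Let orientP l : orient l = l \/ orient l = l^-1.
Proof.
rewrite /orient; case: xgetP => [z -> //|H].
by case: (H l); left.
Qed.

Let orientV l : orient l^-1 = orient l.
Proof.
rewrite /orient; congr (xget 1 _); apply/seteqP; rewrite invgK.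
by split=> z /= [->|->]; auto.
Qed.

Let basis : set Gamma := [set l | edge_label l /\ orient l = l]%classic.

Let letter l : Gamma * bool := if orient l == l then (l, false) else (l^-1, true).

Let letterK l : letter_eval (letter l) = l.
Proof. by rewrite /letter /letter_eval; case: eqP => _ //=; rewrite invgK. Qed.

Let letterV l : l <> 1 -> letter l^-1 = flip_letter (letter l).
Proof.
move=> l1; have /eqP lV := no_involution l1; rewrite /letter orientV /flip_letter invgK.
have [->|->] := orientP l; first by rewrite eqxx eq_sym (negbTE lV).
by rewrite eqxx (negbTE lV).
Qed.

Let letter_basis l : edge_label l -> basis (letter l).1.
Proof.
move=> El; rewrite /letter; case: eqP => [o|]; first by split.
by have [//|o _] := orientP l; split; [exact: edge_labelV|rewrite orientV].
Qed.

Let basis_letter m : basis m.1 -> edge_label (letter_eval m) /\ letter (letter_eval m) = m.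
Proof.
case: m => s b [/= Es os].
have sE : letter s = (s, false) by rewrite /letter os eqxx.
rewrite /letter_eval /=; case: b; last by [].
split; first exact: edge_labelV.
by rewrite letterV ?sE //; case: Es.
Qed.

Let cross (l : Gamma) s := if l == 1 then s else push (letter l) s.

Let cross_sorted l s : sorted (@compatible _) s -> sorted (@compatible _) (cross l s).
Proof. by rewrite /cross; case: ifP => // _; apply: push_sorted. Qed.

Let crossK l s : sorted (@compatible _) s -> cross l^-1 (cross l s) = s.
Proof.
rewrite /cross invg_eq1; case: eqP => // l1 ss.
by rewrite letterV // push_flip_letter.
Qed.

Let crossings (p : seq T) := foldl (fun s l => cross l s) [::] (pairmap label v0 p).

Let crossings_rcons p v : crossings (rcons p v) = cross (label (last v0 p) v) (crossings p).
Proof. by rewrite /crossings -cats1 pairmap_cat foldl_cat. Qed.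

Let crossings_sorted p : sorted (@compatible _) (crossings p).
Proof. by elim/last_ind: p => // p v IHp; rewrite crossings_rcons cross_sorted. Qed.

Let crossings_over p : path (@adj T) v0 p -> word_over basis (crossings p).
Proof.
elim/last_ind: p => // p v IHp; rewrite rcons_path crossings_rcons => /andP[/IHp bp pv].
rewrite /cross; case: eqP => // l1; apply: push_mem bp.
by apply: letter_basis; split=> //; exists (last v0 p), v.
Qed.

Let eval_push (m : Gamma * bool) s :
  word_eval (rev (push m s)) = word_eval (rev s) * letter_eval m.
Proof.
have e1 n : word_eval [:: n] = letter_eval n :> Gamma by rewrite /word_eval big_seq1.
case: s => [|n s] /=; first by rewrite e1 /word_eval big_nil mul1g.
case: eqP => [->|_]; rewrite !rev_cons -!cats1 !word_eval_cat !e1 //.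
by rewrite (letter_eval_flip m) mulgVK.
Qed.

Let crossings_eval p : word_eval (rev (crossings p)) = tile (last v0 p).
Proof.
elim/last_ind: p => [|p v IHp]; first by rewrite /word_eval big_nil tile_base.
rewrite crossings_rcons last_rcons /cross; case: eqP => [l1|_].
  by rewrite IHp; apply/esym/(mulgI (tile (last v0 p))^-1); rewrite mulVg.
by rewrite eval_push letterK IHp mulVKg.
Qed.

(** The reduced word of the tiles met on the way from v0 to v. *)
Let itinerary v := crossings (P v).

(** Along an edge the geodesic is prolonged or shortened by that edge, which
    pushes its label or undoes pushing the inverse label. *)
Let itinerary_adj u v : adj u v -> itinerary v = cross (label u v) (itinerary u).
Proof.
move=> uv; have lP w : last v0 (P w) = w by case: (geodesicP connT v0 w).
rewrite /itinerary; have [->|->] := geodesic_adj connT acycT v0 uv.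
  by rewrite crossings_rcons lP.
by rewrite crossings_rcons lP label_sym crossK.
Qed.

Let itinerary_parent v : itinerary (parent v) = itinerary v.
Proof.
have := parentP v; case: eqP => [_ -> //|_ /andP[pv _]].
by rewrite (itinerary_adj pv) /label tile_parent mulVg /cross eqxx.
Qed.

Let itinerary_tile v : itinerary v = itinerary (act (tile v) v0).
Proof.
rewrite -tileP /root; elim: (lev v) => // k IHk.
by rewrite iterS itinerary_parent.
Qed.

(** The letter m labels an edge from the tile of g to that of g m, whose ends
    have the same itineraries as the translates of v0 in these tiles. *)
Let itinerary_letter g m : basis m.1 ->
  itinerary (act (g * letter_eval m) v0) = push m (itinerary (act g v0)).
Proof.
move=> /basis_letter[[m1 [u [v [uv E]]]] mE].
pose h := g * (tile u)^-1.
have hu : tile (act h u) = g by rewrite tile_act mulgVK.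
have hv : tile (act h v) = g * letter_eval m by rewrite tile_act -mulgA -E.
rewrite -hv -itinerary_tile (@itinerary_adj (act h u)); last by rewrite act_adj.
rewrite label_act E /cross; case: eqP => // _.
by rewrite mE (itinerary_tile (act h u)) hu.
Qed.

Let itinerary_word (ws : seq (Gamma * bool)) : word_over basis ws -> reduced ws ->
  itinerary (act (word_eval ws) v0) = rev ws.
Proof.
elim/last_ind: ws => [_ _|w m IHw Sw].
  by rewrite /word_eval big_nil act1 /itinerary geodesic_base.
rewrite /reduced => red.
have bm : basis m.1 by apply: Sw; rewrite mem_rcons mem_head.
have Sw' : word_over basis w by move=> n nw; apply: Sw; rewrite mem_rcons in_cons nw orbT.
have rw : sorted (@compatible Gamma) (rev (rcons w m)).
  rewrite rev_sorted; apply: sub_sorted red => a b; rewrite compatible_sym; exact.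
have red' : reduced w.
  move: red; rewrite -cats1; case/cat_sorted2; exact.
rewrite -cats1 word_eval_cat {2}/word_eval big_seq1 itinerary_letter // IHw //.
move: rw; rewrite cats1 rev_rcons; case: (rev w) => //= n ws /andP[+ _].
by rewrite compatibleE => /negbTE ->.
Qed.

Lemma free_action_on_tree_free : free_group Gamma.
Proof.
exists basis => g; exists (rev (itinerary (act g v0))); split.
  have [Pp _ Pl] := geodesicP connT v0 (act g v0); split.
  - by move=> m; rewrite mem_rev; apply: crossings_over.
  - rewrite /reduced rev_sorted; apply: sub_sorted (crossings_sorted (P (act g v0))).
    by move=> a b; rewrite compatible_sym; exact.
  - by rewrite crossings_eval Pl tile_act tile_base mulg1.
by move=> w [Sw rw <-]; rewrite itinerary_word // revK.
Qed.
End FreeAction.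

(** * Neighbourhoods in the topology of pointwise convergence *)

Section Topology.
Local Open Scope classical_set_scope.

(** Every neighbourhood in a product contains a box that restricts finitely many
    coordinates: such sets form a filter that converges to f in each
    coordinate. *)
Lemma nbhs_prod_topology (I : eqType) (X : I -> topologicalType)
    (f : prod_topology X) (U : set (prod_topology X)) : nbhs f U ->
  exists (s : seq I) (V : forall i, set (X i)),
    (forall i, nbhs (f i) (V i)) /\
    forall g : prod_topology X, (forall i, i \in s -> V i (g i)) -> U g.
Proof.
pose B : set_system (prod_topology X) := [set A | exists (s : seq I) (V : forall i, set (X i)),
    (forall i, nbhs (f i) (V i)) /\
    forall g : prod_topology X, (forall i, i \in s -> V i (g i)) -> A g].
have FB : Filter B.
  split.
  - by exists [::], (fun i => setT); split=> // i; apply: filterT.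
  - move=> A1 A2 [s1 [V1 [fV1 sA1]]] [s2 [V2 [fV2 sA2]]].
    exists (s1 ++ s2), (fun i => V1 i `&` V2 i); split; first by move=> i; apply: filterI.
    move=> g gV; split; [apply: sA1|apply: sA2] => i si;
      by case: (gV i) => //; rewrite mem_cat si ?orbT.
  - by move=> A1 A2 A12 [s [V [fV sA]]]; exists s, V; split=> // g /sA /A12.
apply: (_ : B --> f); apply/cvg_sup => i A.
rewrite nbhsE => -[_ [[C oC <-] Cf] CA].
exists [:: i], (@eqtype.dfwith I (fun j => set (X j)) (fun j => setT) i C); split.
  by move=> j; case: eqtype.dfwithP => [|k _]; [apply: open_nbhs_nbhs|apply: filterT].
by move=> g /(_ i); rewrite dfwith_in mem_seq1 eqxx => /(_ isT) /CA.
Qed.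

Lemma nbhs_aut (T : graph) (f : graph_aut T) (U : set (graph_aut T)) : nbhs f U ->
  exists s : seq T, forall g, {in s, aut_fun g =1 aut_fun f} -> U g.
Proof.
rewrite nbhsE => -[_ [[C oC <-] Cf] CU].
have [s [V [fV sC]]] := nbhs_prod_topology (open_nbhs_nbhs (conj oC Cf)).
exists s => g gf; apply: CU; apply: sC => x xs.
have := fV x; rewrite [_ x](esym (gf x xs)); exact: nbhs_singleton.
Qed.

Lemma nbhs_ProdAut (I : eqType) (T : I -> graph) (f : ProdAut T)
    (U : set (ProdAut T)) : nbhs f U ->
  exists F : forall i, seq (T i), forall g : ProdAut T,
    (forall i, {in F i, aut_fun (g i) =1 aut_fun (f i)}) -> U g.
Proof.
move=> /nbhs_prod_topology[s [V [fV sU]]].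
pose F i := projT1 (cid (nbhs_aut (fV i))).
have FP i : forall g, {in F i, aut_fun g =1 aut_fun (f i)} -> V i g.
  exact: projT2 (cid (nbhs_aut (fV i))).
by exists F => g gF; apply: sU => i _; apply: FP.
Qed.

Lemma filter_seq (A : eqType) (X : Type) (B : set_system X) (s : seq A)
    (Q : A -> set X) : Filter B ->
  (forall x, x \in s -> B (Q x)) -> B [set y | forall x, x \in s -> Q x y].
Proof.
move=> FB; elim: s => [_|a s IHs Qs]; first exact: filterS filterT.
have H := @filterI _ B FB _ _ (Qs a (mem_head _ _)) 
  (IHs (fun x xs => Qs x (mem_behead (s := a :: s) xs))).
by apply: filterS H => y -[Qa Qy] x; rewrite in_cons => /orP[/eqP -> //|/Qy].
Qed.

Lemma ProdAut_nbhs (I : finType) (T : I -> graph) (f : ProdAut T)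
    (F : forall i, seq (T i)) :
  nbhs f [set g : ProdAut T | forall i x, x \in F i -> aut_fun (g i) x = aut_fun (f i) x].
Proof.
apply: (@filter_forall _ I (fun i => [set g : ProdAut T |
  forall x, x \in F i -> aut_fun (g i) x = aut_fun (f i) x]) _ (nbhs_filter f)) => i.
apply: (@filter_seq _ _ _ _ (fun x => [set g : ProdAut T |
  aut_fun (g i) x = aut_fun (f i) x]) (nbhs_filter f)) => x _.
have c1 : {for f, continuous (fun g : ProdAut T => g i)}.
  exact: (@proj_continuous I (fun i => graph_aut (T i)) i f).
have c2 : {for f i, continuous (@aut_fun (T i) : graph_aut (T i) -> {ptws T i -> discrete_topology (T i)})}.
  exact: initial_continuous.
have c3 : {for aut_fun (f i) : {ptws T i -> discrete_topology (T i)},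
    continuous (fun h : {ptws T i -> discrete_topology (T i)} => h x)}.
  exact: proj_continuous.
have : nbhs (aut_fun (f i) x : discrete_topology (T i)) [set aut_fun (f i) x].
  exact: discrete_set1.
by move/c3/c2/c1.
Qed.
End Topology.

(** * Actions on products of trees *)

Section ProductsOfTrees.
Local Open Scope group_scope.
Variables (Gamma : groupType) (I : finType) (T : I -> graph).
Variable rho : {multiplicative Gamma -> ProdAut T}.
Hypothesis hyp : hyperbolic_group Gamma.
Hypothesis tf : torsion_free Gamma.
Hypothesis nonfree : ~ free_group Gamma.
Hypothesis treeT : forall i, is_tree (T i).
Hypothesis fvT : forall i, finite_valence (T i).
Implicit Types (g h k x y : Gamma) (i : I) (F : forall i, seq (T i)).

Definition act i g : T i -> T i := aut_fun (rho g i).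
Arguments act : clear implicits.

Lemma rho1 : rho 1 = 1.
Proof. by apply: (mulgI (rho 1)); rewrite -gmulfM !mulg1. Qed.

Lemma rhoM g h i : rho (g * h) i = rho g i * rho h i.
Proof. by rewrite gmulfM. Qed.

Lemma rhoV g i : rho g^-1 i = (rho g i)^-1.
Proof.
rewrite (_ : rho g^-1 = (rho g)^-1) //; apply/esym/mulg1_eq.
by rewrite -gmulfM mulgV rho1.
Qed.

Lemma rhoJ g h i : rho (g ^ h) i = rho g i ^ rho h i.
Proof. by rewrite /conjg !rhoM rhoV. Qed.

Lemma rhoR g h i : rho [~ g, h] i = [~ rho g i, rho h i].
Proof. by rewrite /commg rhoM rhoV rhoJ. Qed.

Lemma act1 i v : act i 1 v = v.
Proof. by rewrite /act rho1. Qed.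

Lemma actM i g h v : act i (g * h) v = act i g (act i h v).
Proof. by rewrite /act gmulfM. Qed.

Lemma actK i g : cancel (act i g) (act i g^-1).
Proof. by move=> v; rewrite -actM mulVg act1. Qed.

Lemma act_adj i g u v : adj (act i g u) (act i g v) = adj u v.
Proof. exact: (aut_funP (rho g i)).2. Qed.

Lemma act_fixV i g v : act i g v = v -> act i g^-1 v = v.
Proof. by move=> gv; rewrite -{1}gv actK. Qed.

Lemma act_fixX i g v n : act i g v = v -> act i (g ^+ n) v = v.
Proof.
by move=> gv; elim: n => [|n IHn]; rewrite ?expg0 ?act1 // expgS actM IHn.
Qed.

(** Along a path from v to w, a power that fixes a vertex permutes the finitely
    many neighbours of that vertex. *)
Lemma fixed_vertex_finite_orbits i g v w : act i g v = v ->
  exists2 n, (0 < n)%N & act i (g ^+ n) w = w.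
Proof.
move=> gv; have [_ /(_ v w)[p + <-] _] := treeT i.
elim/last_ind: p => [|p z IHp]; first by exists 1%N.
rewrite rcons_path last_rcons => /andP[/IHp[n n0 nu]]; set u := last v p in nu * => uz.
have [L NL] := (finite_seqP _).1 (fvT u).
have zL m : (m <= size L)%N -> act i ((g ^+ n) ^+ m) z \in L.
  move=> _; suff : [set` L]%classic (act i ((g ^+ n) ^+ m) z) by [].
  by rewrite -NL /= -{1}(act_fixX m nu) act_adj.
have [a [b [ab E]]] := seq_pigeonhole zL.
exists (n * (b - a))%N; first by rewrite muln_gt0 n0 subn_gt0.
apply: (can_inj (actK (g ^+ n ^+ a))).
by rewrite expgnA -actM -expgnDr subnKC 1?ltnW.
Qed.

(** Vertex stabilizers of the action on the i-th tree are trivial: a suitable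
    power of an element that fixes a vertex fixes all of s. *)
Lemma trivial_fixer_free i (s : seq (T i)) :
  (forall g, {in s, forall v, act i g v = v} -> g = 1) -> free_group Gamma.
Proof.
move=> fix1; have [[v0] connT acycT] := treeT i.
apply: (free_action_on_tree_free tf connT acycT (act := act i)) => //.
- exact: act1.
- exact: actM.
- exact: act_adj.
move=> g v gv.
suff [n n0 gn] : exists2 n, (0 < n)%N & {in s, forall w, act i (g ^+ n) w = w}.
  exact: tf n0 (fix1 _ gn).
elim: s {fix1} => [|w s [n n0 IHs]]; first by exists 1%N.
have [m m0 mw] := fixed_vertex_finite_orbits w gv.
exists (m * n)%N; first by rewrite muln_gt0 m0.
move=> u; rewrite in_cons => /orP[/eqP ->|us].
  by rewrite expgnA act_fixX.
by rewrite mulnC expgnA act_fixX // IHs.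
Qed.

Definition faithful_on i := injective (fun g => rho g i).

Lemma rho_eq1P g i : rho g i = 1 <-> forall v, act i g v = v.
Proof.
split=> [E v|gv]; first by rewrite /act E.
by apply: aut_eqP => v; exact: gv.
Qed.

Lemma not_faithful_kernel i : ~ faithful_on i -> exists2 c, c <> 1 & rho c i = 1.
Proof.
move=> nf; apply: contrapT => noc; apply: nf => x y xy.
apply: contrapT => nxy; apply: noc; exists (x^-1 * y).
  by move=> /mulg1_eq; rewrite invgK.
apply/rho_eq1P => v.
by rewrite actM {2}/act -xy -[aut_fun _ _]/(act i x v) actK.
Qed.

Lemma nontrivial : exists g, g <> 1.
Proof.
apply: contrapT => triv; apply: nonfree; apply: (cyclic_free tf (t := 1)) => x.
by exists 0%R; apply: contrapT => x1; apply: triv; exists x.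
Qed.

Definition common_kernel (s : seq I) : set Gamma :=
  [set g | forall i, i \in s -> rho g i = 1]%classic.

(** Centralizers of nontrivial normal subgroups are trivial unless the group is
    free. *)
Lemma common_kernel_noncommuting (s : seq I) k c : common_kernel s k -> k <> 1 -> c <> 1 ->
  exists2 x, common_kernel s x & ~ commute x c.
Proof.
move=> sk k1 c1; apply: contrapT => all_comm; apply: nonfree.
apply: (normal_centralizer_free tf hyp (N := common_kernel s) _ _ _ _ sk k1 c1).
- by move=> i _; rewrite rho1.
- by move=> x y sx sy i si; rewrite rhoM sx // sy // mulg1.
- by move=> x sx i si; rewrite rhoV sx // invg1.
- by move=> x y sx i si; rewrite rhoJ sx // conj1g.
- by move=> x sx; apply: contrapT => xc; apply: all_comm; exists x.
Qed.

(** Two normal subgroups contain the commutators of their elements, so that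
    nontrivial ones have nontrivial intersection. *)
Lemma common_kernel_nontrivial (s : seq I) : {in s, forall i, ~ faithful_on i} ->
  exists2 k, k <> 1 & common_kernel s k.
Proof.
elim: s => [_|i s IHs nf]; first by have [g g1] := nontrivial; exists g.
have [|k k1 sk] := IHs; first by move=> j js; apply: nf; rewrite in_cons js orbT.
have [c c1 ic] := not_faithful_kernel (nf i (mem_head _ _)).
have [x sx xc] := common_kernel_noncommuting sk k1 c1.
exists [~ x, c]; first by move=> /eqP/commgP.
move=> j; rewrite in_cons rhoR.
by case/orP=> [/eqP ->|js]; [rewrite ic commg1|rewrite sx // comm1g].
Qed.

(** For an injective rho this says that the image is discrete: its identity is
    isolated by the basic neighbourhood of the automorphisms that fix the
    vertices in F. *)
Definition trivial_fixer F :=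
  forall g, (forall i, {in F i, forall v, act i g v = v}) -> g = 1.

(** Let k1 and k2 be noncommuting elements that act trivially on the trees on
    which the group does not act faithfully. An element g that fixes the
    vertices in F and their translates by k1 and k2 in the other trees has
    commutators with k1 and k2 that fix all of F. So g commutes with both, which
    only the identity does. *)
Lemma faithful_trivial_fixer F : trivial_fixer F -> exists F',
  trivial_fixer F' /\ forall i, ~ faithful_on i -> F' i = [::].
Proof.
move=> fixF; pose s := [seq i <- enum I | ~~ `[< faithful_on i >]].
have sP i : i \in s <-> ~ faithful_on i.
  by rewrite mem_filter mem_enum andbT -(rwP negP) asboolE.
have [|k1 k11 sk1] := @common_kernel_nontrivial s; first by move=> i /sP.
have [k2 sk2 k12] := common_kernel_noncommuting sk1 k11 k11.
exists (fun i => if `[< faithful_on i >] then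
  F i ++ map (act i k1) (F i) ++ map (act i k2) (F i) else [::]).
split; last by move=> i /asboolPn /negbTE ->.
move=> g fixg.
have comm k : common_kernel s k -> (forall i, faithful_on i ->
    {in F i, forall v, act i g (act i k v) = act i k v}) -> commute k g.
  move=> sk gk; apply/commute_sym/commgP; apply/eqP; apply: fixF => i v Fv.
  have [fi|nfi] := pselect (faithful_on i); last first.
    suff /rho_eq1P : rho [~ g, k] i = 1 by [].
    by rewrite rhoR sk ?commg1 //; apply/sP.
  rewrite !actM gk // actK; apply: act_fixV; apply: fixg.
  by rewrite asboolT // mem_cat Fv.
apply: contrapT => g1; apply: k12; apply: commute_sym.
apply: (commuting_transitive tf hyp g1).
  apply: comm => // i fi v Fv; apply: fixg.
  by rewrite asboolT // !mem_cat map_f ?orbT.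
apply: comm => // i fi v Fv; apply: fixg.
by rewrite asboolT // !mem_cat map_f ?orbT.
Qed.

Hypothesis discr : discrete_rep rho.
Hypothesis faith : faithful_rep rho.

Lemma discrete_trivial_fixer : exists F, trivial_fixer F.
Proof.
have [_ [V V1 VE]] := discr (imageP rho (a := 1) Logic.I).
have [F FP] := nbhs_ProdAut V1; exists F => g gF; apply: faith.
have : (V `&` range rho)%classic (rho g).
  split; last by exists g.
  by apply: FP => i v Fv; rewrite [LHS](gF i v Fv) rho1.
by rewrite VE.
Qed.

Lemma faithful_coordinates_fixer : exists F,
  trivial_fixer F /\ forall i, ~ faithful_on i -> F i = [::].
Proof. by have [F /faithful_trivial_fixer] := discrete_trivial_fixer. Qed.

(** Otherwise finitely many vertices of at most one tree would have trivial
    common fixer, and the group would be free. *)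
Lemma two_faithful_coordinates (s : seq I) : (size s <= 1)%N ->
  exists2 i, i \notin s & faithful_on i.
Proof.
move=> s1; have [F [F1 F0]] := faithful_coordinates_fixer.
apply: contrapT => noi.
have Fs i : i \notin s -> F i = [::].
  by move=> si; apply: F0 => fi; apply: noi; exists i.
case: s s1 Fs {noi} => [|i [|? ?]] // _ Fs.
  by have [g []] := nontrivial; apply: F1 => i v; rewrite Fs.
apply: nonfree; apply: (@trivial_fixer_free i (F i)) => g gF; apply: F1 => j.
have [-> //|ji] := eqVneq j i.
by rewrite Fs // mem_seq1.
Qed.

(** A discrete image would isolate the identity by finitely many vertices of the
    i-th tree alone. *)
Lemma faithful_coordinate_indiscrete i : faithful_on i ->
  ~ discrete_rep (ProdAut_proj i \o rho).
Proof.
move=> fi di; have [_ [V V1 VE]] := di _ (imageP _ (a := 1) Logic.I).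
have [s sP] := nbhs_aut V1.
apply: nonfree; apply: (@trivial_fixer_free i s) => g gs; apply: fi.
have : (V `&` range (ProdAut_proj i \o rho))%classic (rho g i).
  split; last by exists g.
  by apply: sP => v sv; rewrite [LHS](gs v sv) /= rho1.
by rewrite VE.
Qed.

Lemma discrete_rep_faithful_coordinates (J : finType) (e : J -> I) :
  (forall i, faithful_on i -> exists j, i = e j) ->
  discrete_rep (rep_prod (fun j => ProdAut_proj (e j) \o rho)).
Proof.
move=> eP _ [g _ <-]; split; first by rewrite inE; exists g.
have [F [F1 F0]] := faithful_coordinates_fixer.
set f := rep_prod _ g.
exists [set h : ProdAut (fun j => T (e j)) | forall j v, v \in F (e j) ->
  aut_fun (h j) v = aut_fun (f j) v]%classic.
  exact: (ProdAut_nbhs f (fun j => F (e j))).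
apply/seteqP; split=> [h' [/= hf [h _ hE]]|_ ->]; last by split=> //; exists g.
subst h'; rewrite /f; congr (rep_prod _ _); rewrite -[h](mulVKg g).
rewrite (F1 (g^-1 * h)) ?mulg1 // => i v Fv.
have [fi|/F0 Fi] := pselect (faithful_on i); last by rewrite Fi in Fv.
have [j ij] := eP i fi; subst i.
by rewrite actM [act _ h v](_ : _ = act _ g v) ?actK //; exact: hf.
Qed.
End ProductsOfTrees.

Theorem theorem14 (Gamma : groupType)
    (hyp : hyperbolic_group Gamma) (tf : torsion_free Gamma)
    (nonfree : ~ free_group Gamma)
    (n : nat) (T : 'I_n -> graph)
    (treeT : forall i, is_tree (T i)) (fvT : forall i, finite_valence (T i))
    (rho : {multiplicative Gamma -> ProdAut T})
    (discr : discrete_rep rho) (faith : faithful_rep rho) :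
  let rho_ := fun i : 'I_n => ProdAut_proj i \o rho in
  (exists i j : 'I_n,
     [/\ i != j,
         faithful_rep (rho_ i) /\ ~ discrete_rep (rho_ i) &
         faithful_rep (rho_ j) /\ ~ discrete_rep (rho_ j)]) /\
  (forall (r : nat) (le_rn : (r <= n)%N),
     (forall i : 'I_n, faithful_rep (rho_ i) <-> (i < r)%N) ->
     let rho_r := rep_prod (fun j : 'I_r => rho_ (widen_ord le_rn j)) in
     discrete_rep rho_r /\ faithful_rep rho_r).
Proof.
move=> rho_; have faithful_outside :=
  two_faithful_coordinates hyp tf nonfree treeT fvT discr faith.
have indiscrete i : faithful_rep (rho_ i) -> ~ discrete_rep (rho_ i) :=
  faithful_coordinate_indiscrete tf nonfree treeT fvT (i := i).
have [i _ fi] := faithful_outside [::] isT.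
split.
  have [j ji fj] := faithful_outside [:: i] isT.
  exists i, j; rewrite mem_seq1 eq_sym in ji.
  by split=> //; split=> //; apply: indiscrete.
move=> r le_rn fP rho_r; split.
  apply: (discrete_rep_faithful_coordinates hyp tf nonfree discr faith) => k fk.
  have kr : (k < r)%N by apply/fP.
  by exists (Ordinal kr); apply: val_inj.
have ir : (i < r)%N by apply/fP.
have : faithful_rep (rho_ (widen_ord le_rn (Ordinal ir))) by apply/fP.
by move=> inj x y xy; apply: inj; exact: (congr1 (fun f => f (Ordinal ir)) xy).
Qed.
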